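(* Let $\phi^n,\phi^{n-1}\in H^1_{per}(\Omega)$ and $\rho^n,\rho^{n-1},U^n,U^{n-1},V^n,V^{n-1},W^n,W^{n-1}\in L^2_{per}(\Omega)$ be given, let $\delta t>0$, and consider the linear system for $(\phi^{n+1},\mu_\phi^{n+1},\rho^{n+1},\mu_\rho^{n+1})$ with periodic boundary conditions $$\frac{3\phi^{n+1}-4\phi^n+\phi^{n-1}}{2\delta t}=M_1\Delta\mu_\phi^{n+1},\qquad \mu_\phi^{n+1}=-\epsilon\Delta\phi^{n+1}+P_2(\phi^{n+1},\rho^{n+1})+R_1^n,$$ $$\frac{3\rho^{n+1}-4\rho^n+\rho^{n-1}}{2\delta t}=M_2\Delta\mu_\rho^{n+1},\qquad \mu_\rho^{n+1}=Q_2(\phi^{n+1},\rho^{n+1})+R_2^n,$$ where $$P_2(\phi,\rho)=\frac{2}{\epsilon}(\phi^\star)^2\phi+\alpha\nabla\cdot(\rho\boldsymbol Z^\star)-\alpha\nabla\cdot\big((\boldsymbol Z^\star\cdot\nabla\phi)\boldsymbol Z^\star\big),\qquad Q_2(\phi,\rho)=\alpha\rho-\alpha\boldsymbol Z^\star\cdot\nabla\phi+\frac{\beta}{2}(H^\star)^2\rho,$$ $$R_1^n=\frac1\epsilon\phi^\star A_2+\alpha\nabla\cdot(B_2\boldsymbol Z^\star),\qquad R_2^n=\alpha B_2+\beta H^\star C_2,$$ $$A_2=U^\dagger-2\phi^\star\phi^\dagger,\quad B_2=V^\dagger-\rho^\dagger+\boldsymbol Z^\star\cdot\nabla\phi^\dagger,\quad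 C_2=W^\dagger-\tfrac12H^\star\rho^\dagger,$$ with $\phi^\star=2\phi^n-\phi^{n-1}$, $\boldsymbol Z^\star=\boldsymbol Z(2\phi^n-\phi^{n-1})$, $H^\star=H(2\rho^n-\rho^{n-1})$, and $S^\dagger=\frac{4S^n-S^{n-1}}3$ for any variable $S$. This linear system is symmetric positive definite for the variables $(\phi^{n+1},\rho^{n+1})$, in the following sense. Let $\mathbb A$ be the linear operator of the reduced system (obtained by subtracting from $\phi^{n+1},\rho^{n+1}$ their known means and eliminating $\mu_\phi^{n+1},\mu_\rho^{n+1}$ by means of $\Delta^{-1}$), acting on pairs $\boldsymbol X=(X_1,X_2)$ of mean-zero periodic functions by $$\mathbb A\boldsymbol X=\Big(-\frac{3}{2M_1\delta t}\Delta^{-1}X_1-\epsilon\Delta X_1+P_2(X_1,X_2),\ -\frac3{2M_2\delta t}\Delta^{-1}X_2+Q_2(X_1,X_2)\Big)$$ (each component being taken modulo additive constants). Then for all pairs $\boldsymbol X=(X_1,X_2)$, $\boldsymbol Y=(Y_1,Y_2)$ of mean-zero functions with $X_1,Y_1\in H^1_{per}(\Omega)$, $X_2,Y_2\in L^2_{per}(\Omega)$, $$(\mathbb A\boldsymbol X,\boldsymbol Y)=(\mathbb A\boldsymbol Y,\boldsymbol X),\qquad (\mathbb A\boldsymbol X,\boldsymbol X)\ge 0,$$ and $(\mathbb A\boldsymbol X,\boldsymbol X)=0$ if and only if $\boldsymbol X=0$.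
   Context: $\Omega$ is a rectangular periodic box in $\mathbb R^d$, $d=2,3$ (e.g. $[0,2\pi]^d$); $L^2_{per}(\Omega)$, $H^1_{per}(\Omega)$ are the periodic $L^2$ and $H^1$ functions. $(f,g)=\int_\Omega fg\,d\boldsymbol x$ and $\|f\|=\sqrt{(f,f)}$; for pairs, $(\boldsymbol F,\boldsymbol Y)=(F_1,Y_1)+(F_2,Y_2)$. The differential terms are understood weakly: for $Y_1\in H^1_{per}(\Omega)$, $(-\Delta X_1,Y_1)$ means $(\nabla X_1,\nabla Y_1)$ and $(\nabla\cdot\boldsymbol F,Y_1)$ means $-(\boldsymbol F,\nabla Y_1)$. For a mean-zero periodic $u$, $v=\Delta^{-1}u$ is the mean-zero periodic solution of $\Delta v=u$. The parameters $\epsilon,\alpha,\beta,M_1,M_2$ are positive constants. $\boldsymbol Z(\phi)=\nabla\phi/|\nabla\phi|$, with the convention $\boldsymbol Z(\phi)=0$ where $\nabla\phi=0$. $H(\rho)=\dfrac{g(\rho)}{\sqrt{G(\rho)+B}}$ with $g=G'$, where $G:\mathbb R\to\mathbb R$ is the regularized Flory–Huggins potential: for a fixed small $\widehat\epsilon\in(0,1/2)$, $$G(\rho)=\begin{cases}\rho\ln\rho+\frac{(1-\rho)^2}{2\widehat\epsilon}+(1-\rho)\ln\widehat\epsilon-\frac{\widehat\epsilon}{2},&\rho\ge1-\widehat\epsilon,\\ \rho\ln\rho+(1-\rho)\ln(1-\rho),&\widehat\epsilon\le\rho\le1-\widehat\epsilon,\\ (1-\rho)\ln(1-\rho)+\frac{\rho^2}{2\widehat\epsilon}+\rho\ln\widehat\epsilon-\frac{\widehat\epsilon}{2},&\rho\le\widehat\epsilon,\end{cases}$$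 and $B>0$ is a constant such that $G(\rho)+B>0$ for all $\rho$ (e.g. $B=1$). Reduction: integrating the first and third equations determines the means of $\phi^{n+1},\rho^{n+1}$ from those at steps $n,n-1$; the mean-zero parts $(\phi,\rho)$ of $(\phi^{n+1},\rho^{n+1})$ then satisfy $\mathbb A(\phi,\rho)=\boldsymbol b$ modulo additive constants, with $\boldsymbol b$ depending only on known data. *)

(* Defs.v *)
From HB Require Import structures.
From mathcomp Require Import all_boot all_order all_algebra.
From mathcomp Require Import all_classical all_reals all_analysis.

Set Implicit Arguments.
Unset Strict Implicit.
Unset Printing Implicit Defensive.
Import Order.TTheory GRing.Theory Num.Theory.
Import numFieldNormedType.Exports.
Local Open Scope classical_set_scope.
Local Open Scope ring_scope.

(* Lebesgue measure on R^n: 'rV[R]_n carries the product sigma-algebra, as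
   n.-tuple does in the library, and the measure is built by adding one
   coordinate at a time. *)

Definition measure_rV_display : measure_display.
Proof. exact: default_measure_display. Qed.

Section measurable_rV.
Context {R : realType} {n : nat}.

Definition rV_coors (i : 'I_n) (x : 'rV[R]_n) : measurableTypeR R := x 0 i.

Let rV_set0 : g_sigma_preimage rV_coors set0.
Proof. exact: sigma_algebra0. Qed.

Let rV_setC A : g_sigma_preimage rV_coors A -> g_sigma_preimage rV_coors (~` A).
Proof. exact: sigma_algebraC. Qed.

Let rV_bigcup (F : _^nat) : (forall i, g_sigma_preimage rV_coors (F i)) ->
  g_sigma_preimage rV_coors (\bigcup_i (F i)).
Proof. exact: sigma_algebra_bigcup. Qed.

HB.instance Definition _ := @isMeasurable.Build measure_rV_display
  'rV[R]_n (g_sigma_preimage rV_coors) rV_set0 rV_setC rV_bigcup.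

Lemma measurable_rV_coors (i : 'I_n) :
  measurable_fun [set: 'rV[R]_n] (rV_coors i).
Proof.
move=> _ Y mY; rewrite setTI; apply: sub_sigma_algebra => /=.
rewrite -bigcup_seq/=; exists i => /=; first by rewrite mem_index_enum.
by exists Y => //; rewrite setTI.
Qed.

Lemma measurable_fun_rVP d1 (T1 : measurableType d1) (f : T1 -> 'rV[R]_n) :
  (forall i, measurable_fun [set: T1] (rV_coors i \o f)) ->
  measurable_fun [set: T1] f.
Proof.
move=> mf.
suff : g_sigma_preimage (fun i => rV_coors i \o f) `<=` measurable.
  rewrite g_sigma_preimage_comp => prefS _ A mA.
  by rewrite setTI; apply: prefS; exists A => //; rewrite setTI.
apply: smallest_sub; first exact: sigma_algebra_measurable.
rewrite -bigcup_seq => A [i _] [C mC <-].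
exact: mf.
Qed.

End measurable_rV.

Section lebesgue_rV.
Context {R : realType}.

Definition cons_rV n (p : 'rV[R]_n * measurableTypeR R) : 'rV[R]_n.+1 :=
  \row_i (if unlift ord0 i is Some j then p.1 0 j else p.2).

Lemma measurable_cons_rV n : measurable_fun setT (@cons_rV n).
Proof.
apply: measurable_fun_rVP => i.
case: (unliftP ord0 i) => [j ->|->].
- rewrite (_ : _ \o _ = rV_coors j \o fst).
    by apply: measurableT_comp => //; exact: measurable_rV_coors.
  by apply/funext => p; rewrite /= /rV_coors /cons_rV mxE liftK.
- rewrite (_ : _ \o _ = snd) //.
  by apply/funext => p; rewrite /= /rV_coors /cons_rV mxE unlift_none.
Qed.

Definition lebesgue_cons n (mu : {measure set 'rV[R]_n -> \bar R}) :
  set 'rV[R]_n.+1 -> \bar R :=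
  pushforward (mu \x (@lebesgue_measure R))%E (@cons_rV n).

Section lebesgue_cons_measure.
Context n (mu : {measure set 'rV[R]_n -> \bar R}).

Let preim A : measurable A -> measurable (@cons_rV n @^-1` A).
Proof. by move=> mA; rewrite -[X in measurable X]setTI; exact: measurable_cons_rV. Qed.

Let lebesgue_cons0 : lebesgue_cons mu set0 = 0%E.
Proof. by rewrite /lebesgue_cons /pushforward preimage_set0 measure0. Qed.

Let lebesgue_cons_ge0 A : (0 <= lebesgue_cons mu A)%E.
Proof. by rewrite /lebesgue_cons /pushforward; exact: measure_ge0. Qed.

Let lebesgue_cons_sigma_additive : semi_sigma_additive (lebesgue_cons mu).
Proof.
move=> F mF tF mUF; rewrite /lebesgue_cons /pushforward preimage_bigcup.
apply: measure_semi_sigma_additive.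
- by move=> k; exact: preim.
- apply/trivIsetP => /= i j _ _ ij; rewrite -preimage_setI.
  by move/trivIsetP : tF => /(_ _ _ _ _ ij) ->//; rewrite preimage_set0.
- by rewrite -preimage_bigcup; exact: preim.
Qed.

HB.instance Definition _ := isMeasure.Build _ _ _ (lebesgue_cons mu)
  lebesgue_cons0 lebesgue_cons_ge0 lebesgue_cons_sigma_additive.

End lebesgue_cons_measure.

Fixpoint lebesgue_rV n : {measure set 'rV[R]_n -> \bar R} :=
  if n is m.+1 then lebesgue_cons (lebesgue_rV m) else \d_(0 : 'rV[R]_0).

End lebesgue_rV.

Section periodic_spaces.
Context {R : realType} {d : nat}.
Local Notation V := 'rV[R]_d.

(* The period cell Omega = [a_1, b_1] x ... x [a_d, b_d]. *)
Definition box (a b : V) : set V := [set x | forall i, a 0 i <= x 0 i <= b 0 i].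

Lemma measurable_box (a b : V) : measurable (box a b).
Proof.
have -> : box a b = \bigcap_(i in [set: 'I_d]) (rV_coors i @^-1` `[a 0 i, b 0 i]).
  apply/seteqP; split => x /= h i; first by move=> _; rewrite /= in_itv/= h.
  by have := h i I; rewrite /= in_itv.
apply: fin_bigcap_measurable => // i _.
by rewrite -[X in measurable X]setTI; exact: measurable_rV_coors.
Qed.

Variables a b : V.

Definition box_measure : {measure set V -> \bar R} :=
  mrestr (@lebesgue_rV R d) (measurable_box a b).

Definition periodic (f : V -> R) :=
  forall x i, f (x + (b 0 i - a 0 i) *: delta_mx 0 i) = f x.

Definition L2per (f : V -> R) := periodic f /\ f \in Lfun box_measure 2%:E.

Definition ip (f g : V -> R) : R :=
  Rintegral box_measure setT (fun x => f x * g x).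

Definition mean_zero (f : V -> R) := Rintegral box_measure setT f = 0.

(* Euclidean product and norm; the library norm on 'rV is the sup norm. *)
Definition dotv (u v : V) : R := \sum_i u 0 i * v 0 i.
Definition enorm (u : V) : R := Num.sqrt (dotv u u).

Definition ipv (F G : V -> V) : R :=
  Rintegral box_measure setT (fun x => dotv (F x) (G x)).

Definition partial (i : 'I_d) (f : V -> R) : V -> R :=
  fun x => 'D_(delta_mx 0 i : V) f x.

(* C^oo: all iterated partial derivatives exist and are continuous. *)
Definition smooth (f : V -> R) := forall s : seq 'I_d,
  continuous (foldr partial f s) /\
  forall i x, derivable (foldr partial f s) x (delta_mx 0 i : V).

Definition is_weak_grad (u : V -> R) (G : V -> V) :=
  (forall i, L2per (fun x => G x 0 i)) /\
  forall psi, smooth psi -> periodic psi -> forall i,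
    ip u (partial i psi) = - ip (fun x => G x 0 i) psi.

Definition H1per (u : V -> R) := L2per u /\ exists G, is_weak_grad u G.

(* A representative of the weak gradient (unique up to null sets). *)
Definition grad (u : V -> R) : V -> V :=
  xget (fun=> 0) [set G | is_weak_grad u G].

(* Expressions containing weak derivatives are functionals of the test
   function Y in H1per: a function f acts by (f, Y), div F by -(F, grad Y). *)
Definition wfun (f : V -> R) : (V -> R) -> R := fun Y => ip f Y.
Definition wdiv (F : V -> V) : (V -> R) -> R := fun Y => - ipv F (grad Y).
Definition wlap (u : V -> R) : (V -> R) -> R := wdiv (grad u).

(* Delta^{-1} u: the mean-zero periodic weak solution v of Delta v = u
   (a representative; meant for mean-zero u in L2per). *)
Definition is_inv_lap (u v : V -> R) :=
  [/\ H1per v, mean_zero v & forall Y, H1per Y -> wlap v Y = ip u Y].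
Definition inv_lap (u : V -> R) : V -> R :=
  xget (fun=> 0) [set v | is_inv_lap u v].

(* As 0^-1 = 0, this vanishes where grad phi does. *)
Definition Zfield (phi : V -> R) : V -> V :=
  fun x => (enorm (grad phi x))^-1 *: grad phi x.

(* Pairs (X1, X2) of mean-zero functions, X1 in H1per, X2 in L2per. *)
Definition admissible (X : (V -> R) * (V -> R)) :=
  [/\ H1per X.1, mean_zero X.1, L2per X.2 & mean_zero X.2].

Definition eq0_ae (X : (V -> R) * (V -> R)) :=
  {ae box_measure, forall x, X.1 x = 0} /\
  {ae box_measure, forall x, X.2 x = 0}.

Definition pairing (F : ((V -> R) -> R) * ((V -> R) -> R))
    (Y : (V -> R) * (V -> R)) : R := F.1 Y.1 + F.2 Y.2.

Section operator.
Variables (eps alpha beta M1 M2 dt : R).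
(* phis, Zs, Hs stand for the starred coefficients. *)
Variables (phis : V -> R) (Zs : V -> V) (Hs : V -> R).

Definition P2 (phi rho : V -> R) : (V -> R) -> R :=
  (2 / eps) *: wfun (fun x => phis x ^+ 2 * phi x)
  + alpha *: wdiv (fun x => rho x *: Zs x)
  - alpha *: wdiv (fun x => dotv (Zs x) (grad phi x) *: Zs x).

Definition Q2 (phi rho : V -> R) : (V -> R) -> R :=
  alpha *: wfun rho
  - alpha *: wfun (fun x => dotv (Zs x) (grad phi x))
  + (beta / 2) *: wfun (fun x => Hs x ^+ 2 * rho x).

Definition opA (X : (V -> R) * (V -> R)) :
    ((V -> R) -> R) * ((V -> R) -> R) :=
  (- (3 / (2 * M1 * dt)) *: wfun (inv_lap X.1) - eps *: wlap X.1 + P2 X.1 X.2,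
   - (3 / (2 * M2 * dt)) *: wfun (inv_lap X.2) + Q2 X.1 X.2).

End operator.

End periodic_spaces.

Section flory_huggins.
Context {R : realType}.

(* Regularized Flory-Huggins potential; the branches agree at the overlaps
   r = e and r = 1 - e. *)
Definition FH (e r : R) : R :=
  if 1 - e <= r then
    r * ln r + (1 - r) ^+ 2 / (2 * e) + (1 - r) * ln e - e / 2
  else if e <= r then
    r * ln r + (1 - r) * ln (1 - r)
  else
    (1 - r) * ln (1 - r) + r ^+ 2 / (2 * e) + r * ln e - e / 2.

Definition Hfun (e B r : R) : R := derive1 (FH e) r / Num.sqrt (FH e r + B).

End flory_huggins.

(* Main.v *)
Require Import Defs.
From HB Require Import structures.
From mathcomp Require Import all_boot all_order all_algebra.
From mathcomp Require Import all_classical all_reals all_analysis.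
From mathcomp Require Import measurable_realfun.
From mathcomp Require Import zify ring lra.

Import Order.TTheory GRing.Theory Num.Theory.
Import numFieldNormedType.Exports.
Local Open Scope classical_set_scope.
Local Open Scope ring_scope.

(** Moving every derivative onto the second argument turns (A X, Y) into a sum
of integrals that are symmetric in X and Y:
 - the elliptic term eps (grad X_1, grad Y_1);
 - weighted products, with the nonnegative weights 2 phi*^2 / eps and
   beta H*^2 / 2;
 - the two terms c (grad Delta^-1 X_k, grad Delta^-1 Y_k), which is what
   -c (Delta^-1 X_k, Y_k) is when Delta^-1 Y_k is used as a test function;
 - the four alpha terms, which complete each other to
   alpha (X_2 - Z*.grad X_1, Y_2 - Z*.grad Y_1).
On the diagonal this is a sum of squares ([opA_terms]). If it vanishes then
grad X_1 = 0, hence X_1 = 0 because X_1 has mean zero, and then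
X_2 = Z*.grad X_1 = 0.

Two facts of analysis on the period cell make this rigorous: Delta^-1 u exists
for mean-zero u in L2 ([inv_lap_exists]), and a weak gradient is determined
almost everywhere by the function ([weak_grad_ae0]). Both come from Fourier
series. The Hartley functions h_m(x) = cas(w_m.x), with cas = cos + sin and m in
Z^d, form a real orthogonal system that is indexed by Z^d itself, and d_i h_m is
a multiple of h_(-m). The solution of Delta v = u is the series with
coefficients - u_m / |w_m|^2; its terms and those of its gradient are
orthogonal with summable squared norms, so both series converge in L2.

Three things carry the Fourier theory. Integration by parts on the cell
([integral_partial_eq0]) follows from Fubini, one coordinate at a time, and the
fundamental theorem of calculus. Convergence of orthogonal series
([orthogonal_series_cvg]) is the completeness of L2. Totality ([hartley_total]),
that is, that a function orthogonal to all h_m vanishes almost everywhere,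
holds because the trigonometric polynomials form an algebra: polynomials in them
converge boundedly to indicators of orthants, and these generate the
sigma-algebra. *)

Set Implicit Arguments.
Unset Strict Implicit.
Unset Printing Implicit Defensive.

(** * Square-integrable functions *)

Section L2.
Context {dT : measure_display} {T : measurableType dT} {R : realType}.
Variable mu : {measure set T -> \bar R}.
Implicit Types f g h : T -> R.
Local Notation L2 f := (f \in Lfun mu 2%:E).
Local Notation dot f g := (Rintegral mu setT (fun x => f x * g x)).

Lemma L2P (f : T -> R) : L2 f <->
  measurable_fun setT f /\ mu.-integrable setT (EFin \o (fun x => f x ^+ 2)).
Proof.
split=> [fL|[mf intf]].
  by split; [move: (sub_Lfun_mfun fL); rewrite inE | exact: Lfun2_integrable_sqr].
rewrite inE; apply/andP; split; rewrite inE//= /finite_norm unlock /=.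
apply: poweR_lty; move/integrableP : intf => [_].
apply: le_lt_trans; rewrite le_eqVlt; apply/orP; left; apply/eqP.
by apply: eq_integral => x _; rewrite /= powR_mulrn// normrX.
Qed.

Lemma L2_measurable f : L2 f -> measurable_fun setT f.
Proof. by case/L2P. Qed.

Lemma L2_mul_integrable f g : L2 f -> L2 g ->
  mu.-integrable setT (EFin \o (fun x => f x * g x)).
Proof. by move=> fL gL; apply/Lfun1_integrable; exact: Lfun2_mul_Lfun1. Qed.

Lemma integrable_addr f g : mu.-integrable setT (EFin \o f) ->
  mu.-integrable setT (EFin \o g) -> mu.-integrable setT (EFin \o (fun x => f x + g x)).
Proof. by move=> fi gi; apply: (integrableD measurableT fi gi). Qed.

Lemma L2_le f g : measurable_fun setT f -> L2 g ->
  (forall x, `|f x| <= `|g x|) -> L2 f.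
Proof.
move=> mf /L2P[mg ig] fg; apply/L2P; split=> //.
apply: le_integrable ig => //.
  by apply/measurable_EFinP; exact: measurable_funX.
by move=> x _; rewrite /= lee_fin !normrX lerXn2r ?nnegrE.
Qed.

Lemma L2D f g : L2 f -> L2 g -> L2 (fun x => f x + g x).
Proof. by move=> fL gL; have [_] := @Lfun_addr_closed _ _ _ mu 2%:E (lee1n 2); apply. Qed.

Lemma L2Z k f : L2 f -> L2 (fun x => k * f x).
Proof.
move=> fL; have -> : (fun x => k * f x) = (k \o* f) by apply/funext => x /=; rewrite mulrC.
by apply: Lfun_scale => //; rewrite ler1n.
Qed.

Lemma L2N f : L2 f -> L2 (fun x => - f x).
Proof. by move=> /(L2Z (-1)); under eq_fun do rewrite mulN1r. Qed.

Lemma L2B f g : L2 f -> L2 g -> L2 (fun x => f x - g x).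
Proof. by move=> fL gL; apply: (L2D fL (L2N gL)). Qed.

Lemma L20 : L2 (fun=> 0 : R).
Proof. by have [] := @Lfun_addr_closed _ _ _ mu 2%:E (lee1n 2). Qed.

Lemma L2_sum I (s : seq I) (F : I -> T -> R) : (forall i, L2 (F i)) ->
  L2 (fun x => \sum_(i <- s) F i x).
Proof.
move=> FL; elim: s => [|i s IH].
  by under eq_fun do rewrite big_nil; exact: L20.
by under eq_fun do rewrite big_cons; exact: L2D.
Qed.

Lemma dotC f g : dot f g = dot g f.
Proof. by apply: eq_Rintegral => x _; rewrite mulrC. Qed.

Lemma dotDl f g h : L2 f -> L2 g -> L2 h ->
  dot (fun x => f x + g x) h = dot f h + dot g h.
Proof.
move=> fL gL hL; under eq_Rintegral do rewrite mulrDl.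
by rewrite RintegralD//; exact: L2_mul_integrable.
Qed.

Lemma dotZl k f h : L2 f -> L2 h -> dot (fun x => k * f x) h = k * dot f h.
Proof.
move=> fL hL; under eq_Rintegral do rewrite -mulrA.
by rewrite RintegralZl//; exact: L2_mul_integrable.
Qed.

Lemma dotZZ k l f h : L2 f -> L2 h ->
  dot (fun x => k * f x) (fun x => l * h x) = k * l * dot f h.
Proof.
move=> fL hL; rewrite dotZl//; last exact: L2Z.
by rewrite dotC dotZl// mulrA (dotC h).
Qed.

Lemma dotNl f h : L2 f -> L2 h -> dot (fun x => - f x) h = - dot f h.
Proof.
move=> fL hL; rewrite -mulN1r -dotZl//.
by under [RHS]eq_Rintegral do rewrite mulN1r.
Qed.

Lemma dotBl f g h : L2 f -> L2 g -> L2 h ->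
  dot (fun x => f x - g x) h = dot f h - dot g h.
Proof. by move=> fL gL hL; rewrite dotDl ?dotNl//; exact: L2N. Qed.

Lemma dot0l h : dot (fun=> 0) h = 0.
Proof. by under eq_Rintegral do rewrite mul0r; rewrite Rintegral_cst// mul0r. Qed.

Lemma dot_suml I (s : seq I) (F : I -> T -> R) h : (forall i, L2 (F i)) ->
  L2 h -> dot (fun x => \sum_(i <- s) F i x) h = \sum_(i <- s) dot (F i) h.
Proof.
move=> FL hL; elim: s => [|i s IH].
  by under eq_Rintegral do rewrite big_nil; rewrite dot0l big_nil.
under eq_Rintegral do rewrite big_cons.
by rewrite dotDl ?IH ?big_cons//; exact: L2_sum.
Qed.

Lemma dot_ge0 f : 0 <= dot f f.
Proof. by apply: Rintegral_ge0 => x _; rewrite -expr2 sqr_ge0. Qed.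

Lemma dotB2 f g : L2 f -> L2 g ->
  dot (fun x => f x - g x) (fun x => f x - g x) = dot f f - 2 * dot f g + dot g g.
Proof.
move=> fL gL; rewrite dotBl ?dotBl//; try exact: L2B.
rewrite [in LHS]dotC [X in _ - X]dotC !dotBl// (dotC g f); ring.
Qed.

Lemma dot_CauchySchwarz f g : L2 f -> L2 g -> (dot f g) ^+ 2 <= dot f f * dot g g.
Proof.
move=> fL gL; set a := dot f f; set b := dot f g; set c := dot g g.
have a0 : 0 <= a := dot_ge0 f; have c0 : 0 <= c := dot_ge0 g.
have H s : 0 <= a - 2 * s * b + s ^+ 2 * c.
  have sgL := L2Z s gL.
  have E1 : dot f (fun x => s * g x) = s * b by rewrite dotC dotZl// dotC.
  have E2 : dot (fun x => s * g x) (fun x => s * g x) = s ^+ 2 * c.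
    by rewrite dotZl// dotC dotZl// mulrA expr2.
  by have := dot_ge0 (fun x => f x - s * g x); rewrite dotB2// E1 E2 mulrA.
have [c_eq0|cn0] := eqVneq c 0.
  have [->|bn0] := eqVneq b 0; first by rewrite expr0n/= c_eq0 mulr0.
  (* The quadratic is then affine in s with slope -2 b, and this s makes it -1. *)
  have := H ((a + 1) / (2 * b)); rewrite c_eq0 mulr0 addr0.
  have -> : 2 * ((a + 1) / (2 * b)) * b = a + 1 by field.
  lra.
have {}c0 : 0 < c by rewrite lt_def cn0.
have := H (b / c).
have -> : a - 2 * (b / c) * b + (b / c) ^+ 2 * c = (a * c - b ^+ 2) / c by field.
by rewrite pmulr_lge0 ?invr_gt0// subr_ge0.
Qed.

Lemma dot_eq0 f : L2 f -> dot f f = 0 -> {ae mu, forall x, f x = 0}.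
Proof.
move=> fL f0; have iff := L2_mul_integrable fL fL.
have : ae_eq mu setT (EFin \o (fun x => f x * f x)) (cst 0%E).
  apply/ae_eq_integral_abs => //; first exact: measurable_int iff.
  rewrite (eq_integral (EFin \o (fun x => f x * f x))); last first.
    by move=> x _; rewrite /= ger0_norm// -expr2 sqr_ge0.
  by rewrite -[LHS]fineK ?integrable_fin_num//; congr EFin.
by apply: filterS => x /(_ I) [] /eqP; rewrite mulf_eq0 orbb => /eqP.
Qed.

(** Monotonicity holds without measurability, because the integral of a
nonnegative function is a supremum over the simple functions below it. *)
Lemma ge0_le_integral_nomeas (f g : T -> \bar R) :
  (forall x, 0 <= f x)%E -> (forall x, f x <= g x)%E ->
  (\int[mu]_x f x <= \int[mu]_x g x)%E.
Proof.
move=> f0 fg; have g0 x : (0 <= g x)%E := le_trans (f0 x) (fg x).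
rewrite !ge0_integralTE//; apply: ereal_sup_le => _ [s sf <-].
by exists s => // x; exact: le_trans (sf x) (fg x).
Qed.

(** The function, measurable or not, is dominated by the one that is infinite on a
null set and zero elsewhere. This serves for products with arbitrary weights. *)
Lemma ge0_ae0_Rintegral (f : T -> R) : (forall x, 0 <= f x) ->
  {ae mu, forall x, f x = 0} -> Rintegral mu setT f = 0.
Proof.
move=> f0 [N [mN N0 fN]].
suff : (\int[mu]_x (f x)%:E <= 0)%E.
  move=> h; have : (\int[mu]_x (f x)%:E = 0)%E.
    by apply/eqP; rewrite eq_le h integral_ge0// => x _; rewrite lee_fin.
  by rewrite /Rintegral => ->.
have <- : (\int[mu]_x ((fun=> +oo%E) \_ N) x = 0)%E.
  by rewrite -integral_mkcond integral_cst// N0 mule0.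
apply: ge0_le_integral_nomeas => x; first by rewrite lee_fin.
rewrite patchE; case: ifPn => [_|xN]; first by rewrite leey.
rewrite (_ : f x = 0)//; apply: contrapT => fx.
by move: xN; rewrite notin_setE; apply; exact: fN.
Qed.

Lemma dot_ae0 f g : {ae mu, forall x, f x = 0} ->
  measurable_fun setT f -> measurable_fun setT g -> dot f g = 0.
Proof.
move=> f0 mf mg; have -> : 0 = fine (\int[mu]_x (cst 0%E x))%E by rewrite integral0.
congr fine; apply: ae_eq_integral => //.
  by apply/measurable_EFinP; exact: measurable_funM.
by apply: filterS f0 => x -> _; rewrite mul0r.
Qed.

End L2.

(** * Completeness of L2 and orthogonal series *)

Section L2_complete.
Context {dT : measure_display} {T : measurableType dT} {R : realType}.
Variable mu : {measure set T -> \bar R}.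
Hypothesis mu_fin : (mu setT < +oo)%E.
Implicit Types f g h : T -> R.
Local Notation L2 f := (f \in Lfun mu 2%:E).
Local Notation dot f g := (Rintegral mu setT (fun x => f x * g x)).
Local Notation sqnorm f := (dot f f).

Lemma L2_EFin_integral f : L2 f ->
  (\int[mu]_x (f x ^+ 2)%:E)%E = (dot f f)%:E.
Proof.
move=> fL; rewrite /Rintegral fineK; last first.
  by apply: integrable_fin_num => //; exact: L2_mul_integrable.
by apply: eq_integral => x _; rewrite expr2.
Qed.

Lemma cst_integrable (k : R) : mu.-integrable setT (EFin \o cst k).
Proof.
apply/integrableP; split; first exact/measurable_EFinP.
rewrite (_ : (fun x => _) = cst (`|k|%:E)); last by apply/funext.
by rewrite integral_cst//= lte_mul_pinfty.
Qed.

Lemma L2_integrable f : L2 f -> mu.-integrable setT (EFin \o f).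
Proof.
move=> fL; apply/Lfun1_integrable; apply: Lfun_subset12 fL.
by rewrite ge0_fin_numE.
Qed.

(** A form of the bound of the L1 norm by the L2 norm that follows pointwise from
the arithmetic-geometric mean inequality, with a parameter in place of a square
root. *)
Lemma L2_norm_integral_le f (t : R) : L2 f -> 0 < t ->
  (\int[mu]_x `|f x|%:E <= (t^-1 * sqnorm f + t * fine (mu setT))%:E)%E.
Proof.
move=> fL t0; have /L2P[mf if2] := fL.
apply: (@le_trans _ _ (\int[mu]_x (t^-1 * f x ^+ 2 + t)%:E)%E).
  apply: ge0_le_integral => //.
  - by apply/measurable_EFinP; apply: measurableT_comp.
  - apply/measurable_EFinP; apply: measurable_funD => //.
    by apply: measurable_funM => //; exact: measurable_funX.
  move=> x _; rewrite lee_fin -(ler_pM2l t0) mulrDr mulrA divff ?gt_eqF// mul1r.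
  rewrite -(real_normK (num_real (f x))).
  have := sqr_ge0 (`|f x| - t / 2); nra.
under eq_integral do rewrite EFinD.
rewrite integralD//=; last 2 first.
- under eq_fun do rewrite EFinM; exact: integrableZl.
- exact: cst_integrable.
under eq_integral do rewrite EFinM.
rewrite integralZl// L2_EFin_integral// integral_cst// EFinD !EFinM.
by rewrite [(fine (mu _))%:E]fineK// ge0_fin_numE.
Qed.

Lemma geometric_series_le (c : R) : 0 <= c ->
  (\sum_(k <oo) (c / 2 ^+ k)%:E <= (2 * c)%:E)%E.
Proof.
move=> c0; apply: lime_le; first by apply: is_cvg_nneseries => k _ _; rewrite lee_fin divr_ge0.
apply: nearW => n; rewrite sumEFin lee_fin.
have -> : \sum_(0 <= k < n) c / 2 ^+ k = 2 * c - 2 * c / 2 ^+ n.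
  elim: n => [|n IH]; first by rewrite big_nil expr0 divr1 subrr.
  rewrite big_nat_recr//= IH exprS; have p0 : (2 ^+ n : R) != 0 by rewrite expf_neq0.
  by field.
by rewrite lerBlDr lerDl divr_ge0// mulr_ge0.
Qed.

(** The L1 norms of the increments form a convergent geometric series, so the sum
of their absolute values is integrable, hence finite almost everywhere. *)
Lemma fast_cauchy_ae_cvg (G : nat -> T -> R) : (forall k, L2 (G k)) ->
  (forall k, sqnorm (fun x => G k.+1 x - G k x) <= (4 ^+ k)^-1) ->
  {ae mu, forall x, cvgn (fun k => G k x)}.
Proof.
move=> GL Gc; pose c : R := 1 + fine (mu setT).
have c0 : 0 <= c by rewrite addr_ge0// fine_ge0.
pose D k x : \bar R := `|G k.+1 x - G k x|%:E.
have DL k : L2 (fun x => G k.+1 x - G k x) by exact: L2B.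
have mD k : measurable_fun setT (D k).
  by apply/measurable_EFinP; apply: measurableT_comp => //; exact: L2_measurable (DL k).
have D0 k x : (0 <= D k x)%E by rewrite lee_fin.
have iD k : (\int[mu]_x D k x <= (c / 2 ^+ k)%:E)%E.
  apply: (le_trans (@L2_norm_integral_le _ (2 ^+ k)^-1 (DL k) _)).
    by rewrite invr_gt0 exprn_gt0.
  rewrite lee_fin invrK mulrDl mul1r [fine _ * _]mulrC lerD2r.
  rewrite -ler_pdivlMl ?exprn_gt0//; apply: (le_trans (Gc k)).
  by rewrite -invfM -exprMn -natrM.
have iS : (\int[mu]_x (\sum_(k <oo) D k x) < +oo)%E.
  rewrite integral_nneseries//.
  apply: (@le_lt_trans _ _ (2 * c)%:E); last by rewrite ltry.
  apply: le_trans (geometric_series_le c0); apply: lee_nneseries => // k _ _.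
  by apply: integral_ge0.
have intS : mu.-integrable setT (fun x => \sum_(k <oo) D k x)%E.
  apply/integrableP; split; first by apply: ge0_emeasurable_sum.
  by under eq_integral do rewrite gee0_abs ?nneseries_ge0//.
have := integrable_ae measurableT intS; apply: filterS => x /(_ I) Sx.
pose u := telescope (fun k => G k x).
have cu : cvgn (series u).
  apply: normed_cvg; apply: nondecreasing_is_cvgn.
    by apply: nondecreasing_series => k _ _; exact: normr_ge0.
  exists (fine (\sum_(k <oo) D k x)%E) => _ [n _ <-].
  rewrite -lee_fin fineK// /series /= -sumEFin.
  by apply: nneseries_lim_ge => k _ _; exact: D0.
have -> : (fun k => G k x) = (fun k => G 0%N x + series u k).
  by apply/funext => k; rewrite (eq_sum_telescope (fun k => G k x)).
by apply: is_cvgD => //; exact: is_cvg_cst.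
Qed.

Lemma L2_Fatou (f : T -> R) (G : nat -> T -> R) (e : R) :
  (forall k, L2 (G k)) -> measurable_fun setT f ->
  {ae mu, forall x, (fun k => G k x) @ \oo --> f x} ->
  (exists K, forall k, (K <= k)%N -> sqnorm (G k) <= e) ->
  (\int[mu]_x (f x ^+ 2)%:E <= e%:E)%E.
Proof.
move=> GL mf Gf [K Ke].
pose H k x : \bar R := (G (k + K)%N x ^+ 2)%:E.
have mH k : measurable_fun setT (H k).
  by apply/measurable_EFinP; apply: measurable_funX; exact: L2_measurable.
have -> : (\int[mu]_x (f x ^+ 2)%:E = \int[mu]_x limn_einf (H^~ x))%E.
  apply: ae_eq_integral => //.
  - by apply/measurable_EFinP; exact: measurable_funX.
  - have -> : (fun x => limn_einf (H^~ x)) = (fun x => - limn_esup (fun k => - H k x))%E.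
      apply/funext => x; rewrite -limn_einfN; congr limn_einf.
      by apply/funext => k /=; rewrite opprK.
    apply: measurableT_comp => //; apply: measurable_fun_limn_esup => k.
    exact: measurableT_comp.
  apply: filterS Gf => x Gx _.
  have Hx : H^~ x @ \oo --> (f x ^+ 2)%:E.
    apply/cvg_EFin; first exact: nearW.
    rewrite /comp /H /=; under eq_fun do rewrite expr2; rewrite expr2.
    have Gx' : (fun k => G (k + K)%N x) @ \oo --> f x by rewrite (cvg_shiftn K (fun k => G k x)).
    exact: cvgM.
  by rewrite (cvg_limn_einf_sup Hx).1.
apply: le_trans (fatou _ _ _ _) _ => //; first by move=> k x _; rewrite lee_fin sqr_ge0.
rewrite limn_einf_lim; apply: lime_le; first exact: is_cvg_einfs.
apply: nearW => n; apply: ereal_inf_le; exists (\int[mu]_x H n x)%E; first by exists n => //=.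
by rewrite /H L2_EFin_integral// lee_fin Ke// leq_addl.
Qed.

(** Riesz-Fischer theorem. The limit is moreover chosen so that its value at a
point depends only on the values of the sequence there; limits of periodic
functions are thus periodic at every point. *)
Lemma L2_complete (F : nat -> T -> R) : (forall n, L2 (F n)) ->
  (forall e, 0 < e -> exists N, forall n m, (N <= n)%N -> (N <= m)%N ->
     sqnorm (fun x => F n x - F m x) <= e) ->
  exists f, [/\ L2 f,
    forall x y, (forall n, F n x = F n y) -> f x = f y &
    forall e, 0 < e -> exists N, forall n, (N <= n)%N ->
      sqnorm (fun x => F n x - f x) <= e].
Proof.
move=> FL Fc.
have p4 k : 0 < (4 ^+ k : R)^-1 by rewrite invr_gt0 exprn_gt0.
have [N Nc] := choice (fun k => Fc _ (p4 k)).
(* A running maximum makes the index nk k suitable for all tolerances 4^-j, j <= k. *)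
pose nk k := (\max_(j < k.+1) N j)%N.
have nkN k j : (j <= k)%N -> (N j <= nk k)%N.
  rewrite -ltnS => jk.
  exact: (leq_bigmax (F := fun i : 'I_k.+1 => N i) (Ordinal jk)).
pose G k := F (nk k).
have GL k : L2 (G k) by exact: FL.
have Gcvg := fast_cauchy_ae_cvg GL (fun k => Nc k _ _ (nkN _ _ (leqnSn k)) (nkN _ _ (leqnn k))).
(* The upper limit is measurable on the whole space and needs no convergence. *)
pose f x := fine (limn_esup (fun k => (G k x)%:E)).
have Gf : {ae mu, forall x, (fun k => G k x) @ \oo --> f x}.
  apply: filterS Gcvg => x /cvg_ex[l Gl].
  suff -> : f x = l by [].
  have Gl' : (fun k => (G k x)%:E) @ \oo --> l%:E by apply/cvg_EFin => //; exact: nearW.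
  by rewrite /f (cvg_limn_einf_sup Gl').2.
have mf : measurable_fun setT f.
  apply: measurableT_comp => //; apply: measurable_fun_limn_esup => k.
  by apply/measurable_EFinP; exact: L2_measurable.
have mFf n : measurable_fun setT (fun x => F n x - f x).
  by apply: measurable_funB => //; exact: L2_measurable.
have Ff j n : (N j <= n)%N -> (\int[mu]_x ((F n x - f x) ^+ 2)%:E <= ((4 ^+ j)^-1)%:E)%E.
  move=> jn; apply: (@L2_Fatou _ (fun k x => F n x - G k x)) => //.
  - by move=> k; exact: L2B.
  - by apply: filterS Gf => x Gx; apply: cvgB => //; exact: cvg_cst.
  - by exists j => k jk; apply: Nc => //; exact: nkN.
have FfL j n : (N j <= n)%N -> L2 (fun x => F n x - f x).
  move=> jn; apply/L2P; split=> //; apply/integrableP; split.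
    by apply/measurable_EFinP; exact: measurable_funX.
  apply: le_lt_trans (_ : (_ <= ((4 ^+ j)^-1)%:E)%E) _; last by rewrite ltry.
  apply: le_trans (Ff _ _ jn); rewrite le_eqVlt; apply/orP; left; apply/eqP.
  by apply: eq_integral => x _; rewrite /= ger0_norm// sqr_ge0.
exists f; split.
- have := L2B (FL (N 0%N)) (FfL _ _ (leqnn (N 0%N))).
  by under eq_fun do rewrite opprB addrC subrK.
- by move=> x y Fxy; rewrite /f; congr (fine (limn_esup _)); apply/funext => k; rewrite /G Fxy.
- move=> e e0.
  have [j je] : exists j, (4 ^+ j : R)^-1 <= e.
    have [j _ h] : \forall j \near \oo, (4 ^- j : R) <= e.
      have : (4^-1 : R) ^+ j @[j --> \oo] --> (0 : R).
        by apply: cvg_expr; rewrite ger0_norm// invf_lt1// ltr1n.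
      by move=> /cvgr_le /(_ _ e0); apply: filterS => j; rewrite exprVn.
    by exists j; apply: h => /=.
  exists (N j) => n jn; rewrite -lee_fin -L2_EFin_integral; last exact: FfL jn.
  by apply: le_trans (Ff _ _ jn) _; rewrite lee_fin.
Qed.

Lemma sqnorm_orthogonal_sum (phi : nat -> T -> R) (s : seq nat) :
  (forall k, L2 (phi k)) -> (forall j k, j != k -> dot (phi j) (phi k) = 0) ->
  uniq s -> sqnorm (fun x => \sum_(k <- s) phi k x) = \sum_(k <- s) sqnorm (phi k).
Proof.
move=> pL orth us; rewrite dot_suml//; last exact: L2_sum.
apply: eq_big_seq => k ks; rewrite dotC dot_suml// (bigD1_seq k)//= big1 ?addr0//.
by move=> j jk; exact: orth.
Qed.

(** By Pythagoras the partial sums are Cauchy as soon as the squared norms are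
summable. Weak convergence of the series is the form in which it is used. *)
Lemma orthogonal_series_cvg (phi : nat -> T -> R) (K : R) :
  (forall k, L2 (phi k)) -> (forall j k, j != k -> dot (phi j) (phi k) = 0) ->
  (forall n, \sum_(0 <= k < n) sqnorm (phi k) <= K) ->
  exists f, [/\ L2 f,
    forall x y, (forall k, phi k x = phi k y) -> f x = f y &
    forall g, L2 g -> \sum_(0 <= k < n) dot (phi k) g @[n --> \oo] --> dot f g].
Proof.
move=> pL orth bK; pose F n x := \sum_(0 <= k < n) phi k x.
have FL n : L2 (F n) by exact: L2_sum.
pose s := series (fun k => sqnorm (phi k)).
have cs : cvgn s.
  apply: nondecreasing_is_cvgn; last by exists K => _ [n _ <-]; exact: bK.
  by apply: nondecreasing_series => k _ _; exact: dot_ge0.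
have FB n m : (m <= n)%N -> sqnorm (fun x => F n x - F m x) = s n - s m.
  move=> mn; rewrite sub_series_geq// -sqnorm_orthogonal_sum ?iota_uniq//.
  have E x : F n x - F m x = \sum_(m <= k < n) phi k x.
    by rewrite /F (big_cat_nat (leq0n m) mn)/= addrAC subrr add0r.
  by apply: eq_Rintegral => x _; rewrite E.
have /cvg_ex[l sl] := cs.
have sle n : s n <= l.
  rewrite -(cvg_lim _ sl)//; apply: nondecreasing_cvgn_le => //.
  by apply: nondecreasing_series => k _ _; exact: dot_ge0.
have [|f [fL fext fcv]] := L2_complete FL.
  move=> e e0; have : \forall n \near \oo, l - e <= s n.
    by apply: (cvgr_ge _ sl); rewrite gtrBl.
  move=> [N _ HN]; exists N => n m Nn Nm.
  wlog mn : n m Nn Nm / (m <= n)%N.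
    move=> wl; have [/wl|/ltnW/wl] := leqP m n; first exact.
    move=> /(_ Nm Nn); apply: le_trans; rewrite le_eqVlt; apply/orP; left; apply/eqP.
    by apply: eq_Rintegral => x _; rewrite -[RHS]mulrNN !opprB.
  by rewrite FB// lerBlDr addrC -lerBlDr (le_trans _ (HN m Nm))// lerD2r.
exists f; split=> //.
  by move=> x y pxy; apply: fext => n; rewrite /F; apply: eq_bigr => k _; exact: pxy.
move=> g gL; apply/cvgrPdist_le => e e0.
have g1 : 0 < 1 + sqnorm g by rewrite ltr_pwDl// dot_ge0.
have [|N HN] := fcv (e ^+ 2 / (1 + sqnorm g)); first by rewrite divr_gt0// exprn_gt0.
near=> n; rewrite -dot_suml// distrC -dotBl//; last exact: FL.
rewrite -ler_sqr ?nnegrE//; last exact: ltW.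
rewrite real_normK ?num_real//; apply: le_trans (dot_CauchySchwarz (L2B (FL n) fL) gL) _.
apply: (@le_trans _ _ (e ^+ 2 / (1 + sqnorm g) * (1 + sqnorm g))); last first.
  by rewrite divfK// gt_eqF.
apply: ler_pM; rewrite ?dot_ge0//; first by apply: HN; near: n; exact: nbhs_infty_ge.
by rewrite lerDr.
Unshelve. all: by end_near. Qed.

End L2_complete.

(** * Measurability and Lebesgue measure on the period cell *)

Section continuous_measurable.
Context {R : realType} {n : nat}.
Local Notation V := 'rV[R]_n.

Definition grid k (z : 'rV[int]_n) : V := \row_i ((z 0 i)%:~R / 2 ^+ k).
Definition grid_floor k (x : V) : 'rV[int]_n := \row_i Num.floor (x 0 i * 2 ^+ k).

Lemma measurable_grid_cell k z : measurable (grid_floor k @^-1` [set z]).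
Proof.
have -> : grid_floor k @^-1` [set z] =
    \bigcap_(i in [set: 'I_n]) (rV_coors i @^-1` `[grid k z 0 i, grid k (z + const_mx 1) 0 i[).
  have p2 : (0 : R) < 2 ^+ k by rewrite exprn_gt0.
  have H (x : V) i : (Num.floor (x 0 i * 2 ^+ k) == z 0 i) =
      (grid k z 0 i <= x 0 i < grid k (z + const_mx 1) 0 i).
    rewrite !mxE ler_pdivrMr// ltr_pdivlMr//.
    by rewrite real_floor_eq ?num_real// intrD.
  apply/seteqP; split => x /=.
    by move=> zE i _ /=; rewrite in_itv/= -H -zE mxE.
  move=> h; apply/rowP => i; rewrite mxE; apply/eqP; rewrite H.
  by have := h i I; rewrite /= in_itv.
apply: fin_bigcap_measurable => // i _.
by rewrite -[X in measurable X]setTI; exact: measurable_rV_coors.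
Qed.

Lemma grid_floor_dist k (x : V) : `|x - grid k (grid_floor k x)| <= (2 ^+ k)^-1.
Proof.
have p2 : (0 : R) < 2 ^+ k by rewrite exprn_gt0.
rewrite /Num.norm/= mx_normrE; apply: bigmax_le; first by rewrite invr_ge0 ltW.
move=> -[i j] _; rewrite !mxE (ord1 i) /=.
have := @real_floor_itv R (x 0 j * 2 ^+ k) (num_real _); rewrite intrD => /andP[h1 h2].
set f := (Num.floor _)%:~R in h1 h2 *.
have -> : x 0 j - f / 2 ^+ k = (x 0 j * 2 ^+ k - f) / 2 ^+ k by field; rewrite gt_eqF.
rewrite normrM (ger0_norm (x := _^-1)) ?invr_ge0 ?(ltW p2)//.
rewrite ler_piMl ?invr_ge0 ?(ltW p2)// ger0_norm ?subr_ge0//; lra.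
Qed.

(** The sigma-algebra is generated by the coordinates, not by the open sets. A
continuous function is the limit of its values at rounded points, and these take
countably many values, each on a countable union of half-open cubes. *)
Lemma continuous_rV_measurable (f : V -> R) : continuous f -> measurable_fun setT f.
Proof.
move=> cf; pose g k x := f (grid k (grid_floor k x)).
have mg k : measurable_fun setT (g k).
  move=> _ B mB; rewrite setTI.
  have -> : g k @^-1` B = \bigcup_(z in [set z | B (f (grid k z))]) (grid_floor k @^-1` [set z]).
    apply/seteqP; split => x /=; first by exists (grid_floor k x).
    by move=> [z /= Bz]; rewrite /g => ->.
  rewrite bigcup_mkcond; apply: countable_bigcupT_measurable => [|z]; first exact: countableP.
  by case: ifP => _ //; exact: measurable_grid_cell.
have gf x : (fun k => g k x) @ \oo --> f x.
  suff gx : (fun k => grid k (grid_floor k x)) @ \oo --> x by exact: (cvg_comp _ _ gx (cf x)).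
  apply/cvgrPdist_le => e e0; near=> k.
  apply: le_trans (grid_floor_dist k x) _; near: k.
  have : (2^-1 : R) ^+ j @[j --> \oo] --> (0 : R).
    by apply: cvg_expr; rewrite ger0_norm// invf_lt1// ltr1n.
  by move=> /cvgr_le /(_ _ e0); apply: filterS => j; rewrite exprVn.
have -> : f = (fun x => fine (limn_esup (fun k => (g k x)%:E))).
  apply/funext => x.
  have gf' : (fun k => (g k x)%:E) @ \oo --> (f x)%:E.
    by apply/cvg_EFin; [exact: nearW|exact: gf].
  by rewrite (cvg_limn_einf_sup gf').2.
apply: measurableT_comp => //; apply: measurable_fun_limn_esup => k.
exact/measurable_EFinP.
Unshelve. all: by end_near. Qed.

Lemma compact_box (a b : V) : compact (box a b).
Proof.
have -> : box a b = [set v : V | forall i, `[a 0 i, b 0 i]%classic (v ord0 i)].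
  by apply/seteqP; split => x /= h i; have := h i; rewrite /= in_itv.
by apply: (@rV_compact R n (fun i => `[a 0 i, b 0 i]%classic)) => i; exact: segment_compact.
Qed.

End continuous_measurable.

Section box_measure_rec.
Context {R : realType}.

Definition behead_rV {n} (a : 'rV[R]_n.+1) : 'rV[R]_n := \row_j a 0 (lift ord0 j).

Lemma cons_rV_box n (a b : 'rV[R]_n.+1) : @cons_rV R n @^-1` box a b =
  box (behead_rV a) (behead_rV b) `*` `[a 0 0, b 0 0].
Proof.
apply/seteqP; split => [[p t] h | [p t] [/= hp ht] i] /=.
  split=> [j|] /=; first by have := h (lift ord0 j); rewrite /cons_rV !mxE liftK.
  by have := h ord0; rewrite /cons_rV !mxE unlift_none in_itv.
rewrite /cons_rV !mxE; case: (unliftP ord0 i) => [j ->|->] /=.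
  by have := hp j; rewrite !mxE.
by rewrite in_itv/= in ht.
Qed.

Lemma lebesgue_rV_box_fin n (a b : 'rV[R]_n) : (lebesgue_rV n (box a b) < +oo)%E.
Proof.
elim: n a b => [|n IH] a b /=.
  by rewrite /dirac indicE/= ltry.
rewrite /lebesgue_cons /pushforward cons_rV_box product_measure1E//; last exact: measurable_box.
rewrite lte_mul_pinfty//; first by rewrite ge0_fin_numE.
by rewrite /= lebesgue_measure_itv/=; case: ifP => _; rewrite -?EFinB ltry.
Qed.

Lemma box_measure_fin n (a b : 'rV[R]_n) : (box_measure a b setT < +oo)%E.
Proof. by rewrite /= /mrestr setTI; exact: lebesgue_rV_box_fin. Qed.

Lemma measurable_segment (s t : R) : measurable (`[s, t]%classic : set (measurableTypeR R)).
Proof. exact: measurable_itv. Qed.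

Lemma itv_measure_fin (s t : R) : (@lebesgue_measure R (`[s, t]%classic : set (measurableTypeR R)) < +oo)%E.
Proof. by rewrite /= lebesgue_measure_itv/=; case: ifP => _; rewrite -?EFinB ltry. Qed.

(** Bundled as a finite measure, so that the theorems on product measures
apply. *)
Definition itv_measure (s t : R) : {finite_measure set (measurableTypeR R) -> \bar R} :=
  [the {finite_measure set (measurableTypeR R) -> \bar R} of
    mfrestr (measurable_segment s t) (itv_measure_fin s t)].

Definition box_fmeasure n (a b : 'rV[R]_n) : {finite_measure set 'rV[R]_n -> \bar R} :=
  [the {finite_measure set 'rV[R]_n -> \bar R} of
    mfrestr (measurable_box a b) (lebesgue_rV_box_fin a b)].

(** The measure of the cell inherits the product structure of the Lebesgue measure
because the cell is itself a product. *)
Lemma box_measure_cons n (a b : 'rV[R]_n.+1) (A : set 'rV[R]_n.+1) : measurable A ->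
  box_measure a b A =
  (box_fmeasure (behead_rV a) (behead_rV b) \x itv_measure (a ord0 ord0) (b ord0 ord0))%E
    (@cons_rV R n @^-1` A).
Proof.
move=> mA; set a' := behead_rV a; set b' := behead_rV b.
have mB : measurable (box a' b' `*` `[a 0 0, b 0 0]).
  by apply: measurableX => //; exact: measurable_box.
pose m' := mrestr (lebesgue_rV n \x @lebesgue_measure R)%E mB.
rewrite (product_measure_unique (m' := m')); last 2 first.
- move=> X Y mX mY; rewrite /= /mrestr -setXI product_measure1E//.
  - by apply: measurableI => //; exact: measurable_box.
  - exact: measurableI.
- by rewrite -[X in measurable X]setTI; exact: measurable_cons_rV.
by rewrite /= /mrestr /= /lebesgue_cons /pushforward preimage_setI cons_rV_box.
Qed.

End box_measure_rec.

(** * Integration over the period cell *)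

Section restricted_integral.
Context {dT : measure_display} {T : measurableType dT} {R : realType}.
Variables (mu : {measure set T -> \bar R}) (D : set T) (mD : measurable D).
Hypothesis D_fin : (mu D < +oo)%E.
Variable f : T -> R.
Hypothesis mf : measurable_fun setT f.
Hypothesis bf : [bounded f x | x in D].

Lemma mrestr_setC : mrestr mu mD (~` D) = 0%E.
Proof. by rewrite /mrestr setICl measure0. Qed.

Lemma mrestr_integrable : (mrestr mu mD).-integrable setT (EFin \o f).
Proof.
apply/(negligible_integrable (measurableC mD)) => //; first exact/measurable_EFinP.
  exact: mrestr_setC.
rewrite setTD setCK; apply: measurable_bounded_integrable => //.
  by rewrite /= /mrestr setIid.
exact: measurable_funTS.
Qed.

(** The measure is the sum of its restrictions to D and to the complement of D,
and the second one does not charge D. *)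
Lemma integral_mrestr :
  (\int[mrestr mu mD]_x (f x)%:E = \int[mu]_(x in D) (f x)%:E)%E.
Proof.
have mf' : measurable_fun D f by exact: measurable_funTS.
have CD0 : mrestr mu (measurableC mD) D = 0%E by rewrite /mrestr setICr measure0.
rewrite [LHS](negligible_integral (measurableC mD)) ?setTD ?setCK//; last 2 first.
- exact: mrestr_integrable.
- exact: mrestr_setC.
rewrite [RHS](eq_measure_integral (measure_add (mrestr mu mD) (mrestr mu (measurableC mD)))); last first.
  move=> A mA AD; rewrite /= /measure_add /msum 2!big_ord_recl big_ord0 adde0 /= /mrestr.
  rewrite (setIidl AD) (_ : A `&` ~` D = set0) ?measure0 ?adde0//.
  by apply/seteqP; split => x // -[/AD].
rewrite integral_measure_add//.
- rewrite [X in (_ + X)%E]null_set_integral ?adde0//; exact/measurable_EFinP.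
- by apply: measurable_bounded_integrable => //; rewrite /= /mrestr setIid.
- by apply: null_set_integrable => //; exact/measurable_EFinP.
Qed.

End restricted_integral.

Section box_integration.
Context {R : realType}.

Lemma continuous_compact_bounded (T : topologicalType) (f : T -> R) (K : set T) :
  compact K -> continuous f -> [bounded f x | x in K].
Proof.
move=> cK cf; have /compact_bounded[M [_ mrt]] := continuous_compact (continuous_subspaceT cf) cK.
by exists M; split; rewrite ?num_real // => ? ? ? ?; exact: mrt.
Qed.

Lemma box_continuous_integrable n (a b : 'rV[R]_n) (f : 'rV[R]_n -> R) :
  continuous f -> (box_measure a b).-integrable setT (EFin \o f).
Proof.
move=> cf; apply: mrestr_integrable.
- exact: lebesgue_rV_box_fin.
- exact: continuous_rV_measurable.
- by apply: continuous_compact_bounded => //; exact: compact_box.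
Qed.

Lemma itv_measure_integral (s t : R) (f : R -> R) : continuous f ->
  (\int[itv_measure s t]_x (f x)%:E = \int[lebesgue_measure]_(x in `[s, t]) (f x)%:E)%E.
Proof.
move=> cf; rewrite [LHS]integral_mrestr//.
- exact: itv_measure_fin.
- exact: continuous_measurable_fun.
- by apply: continuous_compact_bounded => //; exact: segment_compact.
Qed.

Lemma cons_rV_dist n (p q : 'rV[R]_n) (s t : R) :
  `|cons_rV (p, t) - cons_rV (q, s)| <= `|p - q| + `|t - s|.
Proof.
rewrite [X in X <= _]/Num.norm/= mx_normrE; apply: bigmax_le; first by rewrite addr_ge0.
move=> -[i j] _; rewrite !mxE /=; case: unliftP => [k _|_]; last by rewrite lerDr.
apply: (@le_trans _ _ `|p - q|); last by rewrite lerDl.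
rewrite /Num.norm/= mx_normrE; apply: le_trans (le_bigmax _ _ (ord0, k)).
by rewrite !mxE.
Qed.

Lemma near_dist_le (U : normedModType R) (t : U) e : 0 < e -> \forall s \near t, `|t - s| <= e.
Proof.
move=> e0; have h : s @[s --> t] --> t by exact: cvg_id.
by move/cvgrPdist_le : h => /(_ _ e0).
Qed.

Lemma cons_rV_continuousr n (p : 'rV[R]_n) : continuous (fun t : R => cons_rV (p, t)).
Proof.
move=> t; apply/cvgrPdist_le => e e0.
apply: filterS (@near_dist_le R^o t e e0) => s.
by apply: le_trans; apply: (le_trans (cons_rV_dist _ _ _ _)); rewrite subrr normr0 add0r.
Qed.

Lemma cons_rV_continuousl n (t : R) : continuous (fun p : 'rV[R]_n => cons_rV (p, t)).
Proof.
move=> p; apply/(@cvgrPdist_le _ _ _ _ (nbhs_filter p)) => e e0.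
apply: filterS (@near_dist_le 'rV[R]_n p e e0) => s.
by apply: le_trans; apply: (le_trans (cons_rV_dist _ _ _ _)); rewrite subrr normr0 addr0.
Qed.

Lemma box_Fubini n (a b : 'rV[R]_n.+1) (f : 'rV[R]_n.+1 -> R) : continuous f ->
  let mu' := box_fmeasure (behead_rV a) (behead_rV b) in
  let nu := itv_measure (a 0 0) (b 0 0) in
  (\int[box_measure a b]_x (f x)%:E =
     \int[mu']_p \int[nu]_t (f (cons_rV (p, t)))%:E)%E /\
  (\int[box_measure a b]_x (f x)%:E =
     \int[nu]_t \int[mu']_p (f (cons_rV (p, t)))%:E)%E.
Proof.
move=> cf mu' nu.
have mf : measurable_fun setT (EFin \o f) by apply/measurable_EFinP; exact: continuous_rV_measurable.
have mF : measurable_fun setT (EFin \o f \o @cons_rV R n).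
  by apply: measurableT_comp => //; exact: measurable_cons_rV.
have mabs : measurable_fun setT (fun x => `|f x|%:E).
  by apply/measurable_EFinP; apply: measurableT_comp => //; exact/measurable_EFinP.
have mcons := @measurable_cons_rV R n.
have intF : (mu' \x nu)%E.-integrable setT (EFin \o f \o @cons_rV R n).
  apply/integrableP; split=> //.
  have /integrableP[_] := box_continuous_integrable a b cf.
  apply: le_lt_trans; rewrite le_eqVlt; apply/orP; left; apply/eqP.
  have := @ge0_integral_pushforward _ _ _ _ R _ mcons (mu' \x nu)%E setT (fun x => `|f x|%:E).
  rewrite preimage_setT => <- //.
  by apply: eq_measure_integral => A mA _; rewrite [RHS]box_measure_cons.
have -> : (\int[box_measure a b]_x (f x)%:E = \int[mu' \x nu]_z (EFin \o f \o @cons_rV R n) z)%E.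
  have := @integral_pushforward _ _ _ _ R _ mcons (mu' \x nu)%E setT (EFin \o f).
  rewrite preimage_setT => <- //.
  by apply: eq_measure_integral => A mA _; rewrite [LHS]box_measure_cons.
split; first by rewrite -integral12_prod_meas1.
by rewrite -integral21_prod_meas1.
Qed.

(** A directional derivative only sees the function along a line, so it can be
computed after any change of variables that is affine on that line. *)
Lemma eq_line_derivable (U W : normedModType R) (f : U -> R) (g : W -> R) x u y w :
  (forall h : R, f (h *: u + x) = g (h *: w + y)) ->
  derivable f x u = derivable g y w /\ 'D_u f x = 'D_w g y.
Proof.
move=> fg; have fg0 : f x = g y by have := fg 0; rewrite !scale0r !add0r.
have E : (fun h : R => h^-1 *: ((f \o shift x) (h *: u) - f x)) =
         (fun h : R => h^-1 *: ((g \o shift y) (h *: w) - g y)).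
  by apply/funext => h; rewrite /= fg fg0.
by split; rewrite /derivable /derive E.
Qed.

(** Moving along coordinate 0 is moving the last component of the pair; moving along
another coordinate takes place in the first one. *)
Lemma cons_rV_shift0 n (p : 'rV[R]_n) (t h : R) :
  cons_rV (p, h + t) = h *: delta_mx 0 ord0 + cons_rV (p, t).
Proof.
apply/rowP => k; rewrite !mxE /=; case: unliftP => [j ->|->] /=.
  by rewrite mulr0 add0r.
by rewrite mulr1.
Qed.

Lemma cons_rV_shiftS n (p : 'rV[R]_n) (t h : R) (j : 'I_n) :
  cons_rV (h *: delta_mx 0 j + p, t) = h *: delta_mx 0 (lift ord0 j) + cons_rV (p, t).
Proof.
apply/rowP => k; rewrite !mxE /=; case: (unliftP ord0 k) => [l ->|->] /=.
  by rewrite !mxE (inj_eq lift_inj).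
by rewrite mulr0 add0r.
Qed.

(** Along coordinate 0 the inner integral is the difference of the values of g at
two opposite faces, which agree by periodicity. Any other coordinate is a
coordinate of the lower-dimensional cell, on which the inner integral vanishes by
induction. *)
Lemma integral_partial_eq0 n (a b : 'rV[R]_n) (i : 'I_n) (g : 'rV[R]_n -> R) :
  (forall j, a 0 j < b 0 j) -> continuous g ->
  (forall x, derivable g x (delta_mx 0 i : 'rV[R]_n)) -> continuous (partial i g) ->
  (forall x, g (x + (b 0 i - a 0 i) *: delta_mx 0 i) = g x) ->
  (\int[box_measure a b]_x (partial i g x)%:E = 0)%E.
Proof.
elim: n a b i g => [|n IH] a b i g ab cg dg cpg pg; first by case: i dg cpg pg.
have [F1 F2] := box_Fubini a b cpg.
case: (unliftP ord0 i) => [j|] iE; last first.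
  rewrite F1 integral0_eq// => p _.
  pose phi t := g (cons_rV (p, t)).
  have dphi t : derivable phi t 1 = derivable g (cons_rV (p, t)) (delta_mx 0 i : 'rV[R]_n.+1) /\
      'D_1 phi t = partial i g (cons_rV (p, t)).
    apply: eq_line_derivable => h.
    by rewrite /phi iE -cons_rV_shift0 [_ *: 1]mulr1.
  have cphi : continuous phi.
    by move=> t; apply: (cvg_comp _ _ (@cons_rV_continuousr n p t) (cg _)).
  have cdphi : continuous (fun t => partial i g (cons_rV (p, t))).
    by move=> t; apply: (cvg_comp _ _ (@cons_rV_continuousr n p t) (cpg _)).
  rewrite (@itv_measure_integral _ _ (fun t => partial i g (cons_rV (p, t))))//.
  rewrite (@continuous_FTC2 _ _ phi)//.
  - rewrite -EFinB; congr EFin; apply/eqP; rewrite subr_eq0; apply/eqP.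
    (* The two end points of the segment differ by one period in direction i. *)
    rewrite /phi -[in RHS]pg; congr g.
    rewrite iE addrC -cons_rV_shift0; congr cons_rV; congr pair.
    by rewrite subrK.
  - exact: continuous_subspaceT.
  - split=> [t _| |].
    + by rewrite (dphi t).1.
    + by apply: cvg_at_right_filter; exact: cphi.
    + by apply: cvg_at_left_filter; exact: cphi.
  - by move=> t _; rewrite derive1E (dphi t).2.
rewrite F2 integral0_eq// => t _.
pose h p := g (cons_rV (p, t)).
have dh p : derivable h p (delta_mx 0 j : 'rV[R]_n) =
    derivable g (cons_rV (p, t)) (delta_mx 0 i : 'rV[R]_n.+1) /\
    partial j h p = partial i g (cons_rV (p, t)).
  by apply: eq_line_derivable => s; rewrite /h iE cons_rV_shiftS.
have hE : (fun p => partial i g (cons_rV (p, t))) = partial j h.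
  by apply/funext => p; rewrite (dh p).2.
transitivity (\int[box_measure (behead_rV a) (behead_rV b)]_p (partial j h p)%:E)%E.
  by apply: eq_integral => p _; rewrite (dh p).2.
apply: IH.
- by move=> k; rewrite !mxE.
- by move=> p; apply: (cvg_comp _ _ (@cons_rV_continuousl n t p) (cg _)).
- by move=> p; rewrite (dh p).1.
- by rewrite -hE => p; apply: (cvg_comp _ _ (@cons_rV_continuousl n t p) (cpg _)).
- by move=> p; rewrite /h addrC cons_rV_shiftS !mxE -iE addrC pg.
Qed.

Lemma Rintegral_partial_eq0 n (a b : 'rV[R]_n) (i : 'I_n) (g : 'rV[R]_n -> R) :
  (forall j, a 0 j < b 0 j) -> continuous g ->
  (forall x, derivable g x (delta_mx 0 i : 'rV[R]_n)) -> continuous (partial i g) ->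
  (forall x, g (x + (b 0 i - a 0 i) *: delta_mx 0 i) = g x) ->
  Rintegral (box_measure a b) setT (partial i g) = 0.
Proof. by move=> ab cg dg cpg pg; exact: (congr1 fine (integral_partial_eq0 ab cg dg cpg pg)). Qed.

(** This makes the faces of the cell negligible. *)
Lemma lebesgue_rV_hyperplane n (i : 'I_n) (c : R) :
  lebesgue_rV n [set x : 'rV[R]_n | x 0 i = c] = 0%E.
Proof.
elim: n i => [[]//|n IH] i.
rewrite /= /lebesgue_cons /pushforward.
case: (unliftP ord0 i) => [j|] ->.
  rewrite (_ : _ @^-1` _ = [set p : 'rV[R]_n | p 0 j = c] `*` setT); last first.
    by apply/seteqP; split => -[p t]; rewrite /= !mxE liftK//= => -[].
  have mj : measurable [set p : 'rV[R]_n | p 0 j = c].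
    rewrite -[X in measurable X]setTI; apply: (@measurable_rV_coors R n j measurableT [set c]).
    exact: measurable_set1.
  by rewrite product_measure1E// IH mul0e.
rewrite (_ : _ @^-1` _ = setT `*` [set c]); last first.
  by apply/seteqP; split => -[p t]; rewrite /= !mxE unlift_none//= => -[].
have c0 : @lebesgue_measure R ([set c] : set (measurableTypeR R)) = 0%E.
  exact: lebesgue_measure_set1.
by rewrite product_measure1E// [X in (_ * X)%E]c0 mule0.
Qed.

Lemma box_measure_gt0 n (a b : 'rV[R]_n) : (forall i, a 0 i < b 0 i) ->
  0 < fine (box_measure a b setT).
Proof.
move=> ab; apply: fine_gt0; rewrite box_measure_fin andbT.
rewrite /= /mrestr setTI.
elim: n a b ab => [|n IH] a b ab /=.
  by rewrite /dirac indicE/= mem_set ?lte01//= => -[].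
rewrite /lebesgue_cons /pushforward cons_rV_box product_measure1E//; last exact: measurable_box.
apply: mule_gt0; first by apply: IH => i; rewrite !mxE.
by rewrite /= lebesgue_measure_itv/= lte_fin ab -EFinB lte_fin subr_gt0.
Qed.

End box_integration.

(** * Hartley functions *)

Section continuous_arithmetic.
Context {R : realType} {T : topologicalType}.
Implicit Types f g : T -> R.

Lemma continuous_addr f g : continuous f -> continuous g ->
  continuous (fun x => f x + g x).
Proof. by move=> cf cg x; apply: cvgD; [exact: cf|exact: cg]. Qed.

Lemma continuous_subr f g : continuous f -> continuous g ->
  continuous (fun x => f x - g x).
Proof. by move=> cf cg x; apply: cvgB; [exact: cf|exact: cg]. Qed.

Lemma continuous_mulr f g : continuous f -> continuous g ->
  continuous (fun x => f x * g x).
Proof. by move=> cf cg x; apply: cvgM; [exact: cf|exact: cg]. Qed.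

End continuous_arithmetic.

Section hartley.
Context {R : realType} {d : nat}.
Local Notation V := 'rV[R]_d.
Variables (a b : V).
Hypothesis ab : forall i, a 0 i < b 0 i.
Local Notation mu := (box_measure a b).
Local Notation e_ i := (delta_mx 0 i : 'rV[R]_d).

Lemma period_neq0 i : b 0 i - a 0 i != 0.
Proof. by rewrite gt_eqF// subr_gt0. Qed.

Definition cas (t : R) : R := cos t + sin t.

Definition freq (m : 'rV[int]_d) : V :=
  \row_i (pi *+ 2 * (m 0 i)%:~R / (b 0 i - a 0 i)).

(** The real counterparts of the complex exponentials. Unlike sines and cosines
they need no choice of a representative between m and -m. *)
Definition hartley (m : 'rV[int]_d) (x : V) : R := cas (dotv (freq m) x).

Lemma freqN m : freq (- m) = - freq m.
Proof. by apply/rowP => i; rewrite !mxE mulrNz mulrN mulNr. Qed.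

Lemma freq0 : freq 0 = 0.
Proof. by apply/rowP => i; rewrite !mxE mulr0 mul0r. Qed.

Lemma freqD m n : freq (m + n) = freq m + freq n.
Proof. by apply/rowP => i; rewrite !mxE intrD mulrDr mulrDl. Qed.

Lemma dotvC (u v : V) : dotv u v = dotv v u.
Proof. by apply: eq_bigr => i _; rewrite mulrC. Qed.

Lemma dotvDl (u v w : V) : dotv (u + v) w = dotv u w + dotv v w.
Proof. by rewrite /dotv -big_split/=; apply: eq_bigr => i _; rewrite mxE mulrDl. Qed.

Lemma dotvZl k (u w : V) : dotv (k *: u) w = k * dotv u w.
Proof. by rewrite /dotv mulr_sumr; apply: eq_bigr => i _; rewrite mxE mulrA. Qed.

Lemma dotvNl (u w : V) : dotv (- u) w = - dotv u w.
Proof. by rewrite -scaleN1r dotvZl mulN1r. Qed.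

Lemma dotv0l (w : V) : dotv 0 w = 0.
Proof. by rewrite -(scale0r 0) dotvZl mul0r. Qed.

Lemma dotv_delta (u : V) i : dotv u (e_ i) = u 0 i.
Proof.
rewrite /dotv (bigD1 i)//= big1 ?addr0 => [|j ji]; first by rewrite mxE !eqxx mulr1.
by rewrite mxE eqxx/= (negbTE ji) mulr0.
Qed.

Lemma casDz (t : R) (k : int) : cas (t + pi *+ 2 * k%:~R) = cas t.
Proof.
have H s n : cas (s + pi *+ 2 *+ n) = cas s.
  by rewrite /cas (periodicn (@cosD2pi R)) (periodicn (@sinD2pi R)).
case: k => n; first by rewrite pmulrn mulr_natr H.
by rewrite NegzE mulrNz mulrN -(H _ n.+1) pmulrn mulr_natr subrK.
Qed.

Lemma hartley0 x : hartley 0 x = 1.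
Proof. by rewrite /hartley freq0 dotv0l /cas cos0 sin0 addr0. Qed.

Lemma hartley_periodic m : Defs.periodic a b (hartley m).
Proof.
move=> x i; rewrite /hartley dotvC dotvDl dotvZl dotvC (dotvC (e_ i)) dotv_delta mxE.
by rewrite mulrC divfK ?period_neq0// casDz.
Qed.

Lemma is_derive_cas (t : R) : is_derive t 1 cas (cas (- t)).
Proof.
have -> : cas (- t) = - sin t + cos t by rewrite /cas cosN sinN addrC.
exact: (@is_deriveD _ _ _ cos sin).
Qed.

Lemma differentiable_cas (t : R) : differentiable cas t.
Proof. by apply/derivable1_diffP; case: (is_derive_cas t). Qed.

Lemma derive_cas (t w : R) : 'D_w cas t = w * cas (- t).
Proof.
rewrite deriveE; last exact: differentiable_cas.
have {1}-> : w = w *: (1 : R^o) by rewrite [RHS]mulr1.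
rewrite linearZ/= -deriveE; last exact: differentiable_cas.
by have [_ ->] := is_derive_cas t.
Qed.

Lemma continuous_cas : continuous cas.
Proof. by move=> t; apply: cvgD; [exact: continuous_cos|exact: continuous_sin]. Qed.

Lemma continuous_dotv (u : V) : continuous (dotv u).
Proof.
rewrite /dotv; elim: (index_enum _) => [|i s IH].
  by under eq_fun do rewrite big_nil; exact: cst_continuous.
under eq_fun do rewrite big_cons.
apply: continuous_addr IH; apply: continuous_mulr; first exact: cst_continuous.
exact: coord_continuous.
Qed.

Lemma continuous_hartley m : continuous (hartley m).
Proof.
by move=> x; apply: (cvg_comp _ _ (@continuous_dotv (freq m) x) (@continuous_cas _)).
Qed.

(** The Hartley functions are closed under differentiation up to the sign of the
mode, since cas'(t) = cas(-t). *)
Lemma hartley_partial m i x : derivable (hartley m) x (e_ i) /\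
  partial i (hartley m) x = freq m 0 i * hartley (- m) x.
Proof.
have line : forall h : R, hartley m (h *: e_ i + x) =
    cas (h *: freq m 0 i + dotv (freq m) x).
  by move=> h; rewrite /hartley dotvC dotvDl dotvZl dotvC dotv_delta (dotvC x).
have [-> E] := @eq_line_derivable R _ R^o _ cas _ _ _ _ line.
split; first exact/diff_derivable/differentiable_cas.
by rewrite /partial E derive_cas /hartley freqN dotvNl.
Qed.

(** The trigonometric polynomials, as the span of the Hartley functions. *)
Inductive trig : (V -> R) -> Prop :=
| trig_hartley m : trig (hartley m)
| trig0 : trig (fun=> 0)
| trigD f g : trig f -> trig g -> trig (fun x => f x + g x)
| trigZ k f : trig f -> trig (fun x => k * f x).

Lemma trig_continuous f : trig f -> continuous f.
Proof.
elim=> {f} [m||f g _ cf _ cg|k f _ cf].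
- exact: continuous_hartley.
- exact: cst_continuous.
- exact: continuous_addr.
- by apply: continuous_mulr => //; exact: cst_continuous.
Qed.

Lemma trig_periodic f : trig f -> Defs.periodic a b f.
Proof.
elim=> {f} [m||f g _ pf _ pg|k f _ pf] x i //.
- exact: hartley_periodic.
- by rewrite pf pg.
- by rewrite pf.
Qed.

Lemma trig_partial f i : trig f ->
  (forall x, derivable f x (e_ i)) /\ trig (partial i f).
Proof.
elim=> {f} [m||f g _ [df tf] _ [dg tg]|k f _ [df tf]].
- split; first by move=> x; have [] := hartley_partial m i x.
  have -> : partial i (hartley m) = fun x => freq m 0 i * hartley (- m) x.
    by apply/funext => x; have [] := hartley_partial m i x.
  by apply: trigZ; exact: trig_hartley.
- split; first by move=> x; exact: derivable_cst.
  have -> : partial i (fun=> 0 : R) = fun=> 0 by apply/funext => x; exact: derive_cst.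
  exact: trig0.
- split; first by move=> x; exact: (@derivableD _ _ _ f g).
  have -> : partial i (fun x => f x + g x) = fun x => partial i f x + partial i g x.
    by apply/funext => x; exact: (@deriveD _ _ _ f g).
  exact: trigD.
- split; first by move=> x; exact: (@derivableZ _ _ _ f).
  have -> : partial i (fun x => k * f x) = fun x => k * partial i f x.
    by apply/funext => x; exact: (@deriveZ _ _ _ f).
  exact: trigZ.
Qed.

Lemma trig_smooth f : trig f -> smooth f.
Proof.
move=> tf s; have ts : trig (foldr partial f s).
  by elim: s => //= i s; exact: (fun t => (trig_partial i t).2).
split; first exact: trig_continuous.
by move=> i x; apply: (trig_partial i ts).1.
Qed.

Lemma cos_hartley m x : cos (dotv (freq m) x) = 2^-1 * (hartley m x + hartley (- m) x).
Proof. by rewrite /hartley freqN dotvNl /cas cosN sinN; field. Qed.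

Lemma sin_hartley m x : sin (dotv (freq m) x) = 2^-1 * (hartley m x - hartley (- m) x).
Proof. by rewrite /hartley freqN dotvNl /cas cosN sinN; field. Qed.

Lemma trig_cos m : trig (fun x => cos (dotv (freq m) x)).
Proof.
under eq_fun do rewrite cos_hartley.
by apply: trigZ; apply: trigD; exact: trig_hartley.
Qed.

Lemma trig_sin m : trig (fun x => sin (dotv (freq m) x)).
Proof.
under eq_fun do rewrite sin_hartley -[- hartley _ _]mulN1r.
by apply: trigZ; apply: trigD; [|apply: trigZ]; exact: trig_hartley.
Qed.

(** The product-to-sum formula that makes the trigonometric polynomials an
algebra. *)
Lemma hartleyM m n x : hartley m x * hartley n x =
  cos (dotv (freq (m - n)) x) + sin (dotv (freq (m + n)) x).
Proof.
rewrite /hartley /cas !freqD freqN !dotvDl dotvNl cosB sinD; ring.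
Qed.

Lemma trigM f g : trig f -> trig g -> trig (fun x => f x * g x).
Proof.
move=> tf tg; elim: tf => {f} [m||f f' _ IH _ IH'|k f _ IH].
- elim: tg => {g} [n||g g' _ IH _ IH'|k g _ IH].
  + under eq_fun do rewrite hartleyM.
    by apply: trigD; [exact: trig_cos|exact: trig_sin].
  + by under eq_fun do rewrite mulr0; exact: trig0.
  + by under eq_fun do rewrite mulrDr; exact: trigD.
  + by under eq_fun do rewrite mulrCA; exact: trigZ.
- by under eq_fun do rewrite mul0r; exact: trig0.
- by under eq_fun do rewrite mulrDl; exact: trigD.
- by under eq_fun do rewrite -mulrA; exact: trigZ.
Qed.

Lemma trig_cst k : trig (fun=> k).
Proof.
have -> : (fun _ : V => k) = fun x => k * cos (dotv (freq 0) x).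
  by apply/funext => x; rewrite freq0 dotv0l cos0 mulr1.
by apply: trigZ; exact: trig_cos.
Qed.

Lemma trigX f k : trig f -> trig (fun x => f x ^+ k).
Proof.
move=> tf; elim: k => [|k IH]; first exact: trig_cst.
by under eq_fun do rewrite exprS; exact: trigM.
Qed.

Lemma trig_prod (I : finType) (F : I -> V -> R) : (forall i, trig (F i)) ->
  trig (fun x => \prod_i F i x).
Proof.
move=> tF; elim: (index_enum I) => [|i s IH].
  by under eq_fun do rewrite big_nil; exact: trig_cst.
by under eq_fun do rewrite big_cons; exact: trigM.
Qed.

Lemma continuous_L2 f : continuous f -> f \in Lfun mu 2%:E.
Proof.
move=> cf; apply/L2P; split; first exact: continuous_rV_measurable.
apply: (@box_continuous_integrable _ _ _ _ (fun x => f x ^+ 2)).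
by under eq_fun do rewrite expr2; exact: continuous_mulr.
Qed.

Lemma trig_L2per f : trig f -> L2per a b f.
Proof. by move=> tf; split; [exact: trig_periodic|exact/continuous_L2/trig_continuous]. Qed.

(** Integrate the derivative of the product over a period. *)
Lemma ip_partial f g i : continuous f -> (forall x, derivable f x (e_ i)) ->
  continuous (partial i f) -> continuous g -> (forall x, derivable g x (e_ i)) ->
  continuous (partial i g) -> Defs.periodic a b f -> Defs.periodic a b g ->
  ip a b f (partial i g) = - ip a b (partial i f) g.
Proof.
move=> cf df cpf cg dg cpg pf pg.
have E : partial i (fun x => f x * g x) = fun x => f x * partial i g x + partial i f x * g x.
  by apply/funext => x; rewrite /partial (@deriveM _ _ f g)// addrC [X in X + _]mulrC addrC.
have cfg : continuous (fun x => f x * partial i g x + partial i f x * g x).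
  exact: (continuous_addr (continuous_mulr cf cpg) (continuous_mulr cpf cg)).
have : Rintegral mu setT (partial i (fun x => f x * g x)) = 0.
  apply: (Rintegral_partial_eq0 ab) => [|x||x].
  - exact: continuous_mulr.
  - exact: (@derivableM _ _ f g).
  - by rewrite E.
  - by rewrite pf pg.
rewrite E.
rewrite RintegralD//; last 2 first.
- by apply: L2_mul_integrable; exact: continuous_L2.
- by apply: L2_mul_integrable; exact: continuous_L2.
by move/eqP; rewrite addr_eq0 => /eqP.
Qed.

Lemma mode_neq0 (m : 'rV[int]_d) : m != 0 -> exists i, m 0 i != 0.
Proof.
move=> /eqP m0; apply: contrapT => h; apply: m0; apply/rowP => i; rewrite mxE.
by apply: contrapT => /eqP mi; apply: h; exists i.
Qed.

(** For m nonzero, h_m is up to a factor a partial derivative of h_(-m). *)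
Lemma integral_hartley m : m != 0 -> Rintegral mu setT (hartley m) = 0.
Proof.
move=> m0; have [i mi] := mode_neq0 m0.
have w0 : freq (- m) 0 i != 0.
  rewrite !mxE mulf_neq0 ?invr_neq0 ?period_neq0// mulf_neq0//.
    by rewrite gt_eqF// pmulrn_lgt0// pi_gt0.
  by rewrite intr_eq0 oppr_eq0.
have E : hartley m = fun x => (freq (- m) 0 i)^-1 * partial i (hartley (- m)) x.
  by apply/funext => x; rewrite (hartley_partial (- m) i x).2 opprK mulKf.
have [dh th] := trig_partial i (trig_hartley (- m)).
rewrite E RintegralZl//; last by apply: box_continuous_integrable; exact: trig_continuous.
rewrite (Rintegral_partial_eq0 ab) ?mulr0//.
- exact: continuous_hartley.
- exact: trig_continuous.
- by move=> x; exact: hartley_periodic.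
Qed.

Local Notation vol := (fine (mu setT)).

Lemma hartley_orthogonal m n :
  ip a b (hartley m) (hartley n) = if m == n then vol else 0.
Proof.
rewrite /ip; under eq_Rintegral do rewrite hartleyM.
have icos k : Rintegral mu setT (fun x => cos (dotv (freq k) x)) = if k == 0 then vol else 0.
  have [->|k0] := eqVneq k 0.
    under eq_Rintegral do rewrite freq0 dotv0l cos0.
    by rewrite Rintegral_cst// mul1r.
  under eq_Rintegral do rewrite cos_hartley.
  rewrite RintegralZl//; last first.
    apply: (@box_continuous_integrable _ _ _ _ (fun x => hartley k x + hartley (- k) x)).
    by apply: trig_continuous; apply: trigD; exact: trig_hartley.
  rewrite RintegralD//; [|by apply: box_continuous_integrable; exact: continuous_hartley..].
  by rewrite !integral_hartley ?oppr_eq0// addr0 mulr0.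
have isin k : Rintegral mu setT (fun x => sin (dotv (freq k) x)) = 0.
  have [->|k0] := eqVneq k 0.
    under eq_Rintegral do rewrite freq0 dotv0l sin0.
    by rewrite Rintegral_cst// mul0r.
  under eq_Rintegral do rewrite sin_hartley.
  have ci l := box_continuous_integrable a b (@continuous_hartley l).
  rewrite RintegralZl//; last first.
    apply: (@box_continuous_integrable _ _ _ _ (fun x => hartley k x - hartley (- k) x)).
    by apply: continuous_subr; exact: continuous_hartley.
  by rewrite RintegralB// !integral_hartley ?oppr_eq0// subr0 mulr0.
rewrite RintegralD//; last 2 first.
- by apply: box_continuous_integrable; apply: trig_continuous; exact: trig_cos.
- by apply: box_continuous_integrable; apply: trig_continuous; exact: trig_sin.
by rewrite icos isin addr0 subr_eq0.
Qed.

End hartley.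

(** * Polynomial approximation of a step *)

Section step_approximation.
Context {R : realType}.

Lemma Bernoulli_le (x : R) n : -1 <= x -> 1 + n%:R * x <= (1 + x) ^+ n.
Proof.
move=> x1; elim: n => [|n IH]; first by rewrite mul0r addr0 expr0.
rewrite exprS -natr1; apply: le_trans (_ : (1 + x) * (1 + n%:R * x) <= _).
  have : 0 <= n%:R * x ^+ 2 by rewrite mulr_ge0// sqr_ge0.
  lra.
by rewrite ler_wpM2l//; lra.
Qed.

Definition step_base n (y : R) : R := 2^-1 + y / 8 + (n.+4%:R)^-1.

(** Polynomials in y that converge to the indicator of y < 0, boundedly on
[-2, 2]. With t the base and N = (n + 4)^2, the value (1 - t^N)^(2^N) is close to 1
or to 0 according as (2 t)^N is small or large, that is, as t is below or above
1/2. The shift 1/(n + 4) puts y = 0 on the second side, and the square in N makes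
the shift count: (1 + 2/(n + 4))^N is at least 2 (n + 4). *)
Definition step_approx n (y : R) : R :=
  (1 - step_base n y ^+ (n.+4 ^ 2)) ^+ (2 ^ (n.+4 ^ 2)).

Lemma step_base_itv n y : `|y| <= 2 -> 0 <= step_base n y <= 1.
Proof.
rewrite ler_norml => /andP[y1 y2]; rewrite /step_base.
have n0 : 0 <= (n.+4%:R : R)^-1 by rewrite invr_ge0.
have n4 : (n.+4%:R : R)^-1 <= 4^-1 by rewrite lef_pV2 ?posrE// ler_nat.
by move: (n.+4%:R^-1) n0 n4 => k n0 n4; apply/andP; split; lra.
Qed.

Lemma step_approx_itv n y : `|y| <= 2 -> 0 <= step_approx n y <= 1.
Proof.
move=> /(step_base_itv n) /andP[t0 t1].
have u1 : step_base n y ^+ (n.+4 ^ 2) <= 1 by rewrite exprn_ile1.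
have u0 : 0 <= step_base n y ^+ (n.+4 ^ 2) by rewrite exprn_ge0.
apply/andP; split; first by rewrite exprn_ge0// subr_ge0.
by rewrite exprn_ile1 ?subr_ge0// gerBl.
Qed.

(** Bernoulli gives the lower bound 1 - (2 t)^N, where 2 t stays below some r < 1. *)
Lemma step_approx_lt0 y : `|y| <= 2 -> y < 0 ->
  step_approx n y @[n --> \oo] --> (1 : R).
Proof.
move=> y2 y0; pose r := 1 + y / 8.
have y2' : -2 <= y by move: y2; rewrite ler_norml => /andP[].
have r0 : 0 <= r by rewrite /r; lra.
have r1 : r < 1 by rewrite /r; lra.
have cr : (fun n => r ^+ n) @ \oo --> 0 by apply: cvg_expr; rewrite ger0_norm.
apply: (squeeze_cvgr (f := fun n => 1 - r ^+ n) (h := fun=> 1)); last 2 first.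
- by rewrite -[X in _ --> X]subr0; apply: cvgB => //; exact: cvg_cst.
- exact: cvg_cst.
have : (fun n => (n.+4%:R : R)^-1) @ \oo --> (0 : R).
  by have := @cvg_harmonic R; rewrite -(cvg_shiftn 3); under eq_fun do rewrite /harmonic addnC.
have y16 : 0 < - y / 16 by lra.
move=> /cvgr_le /(_ _ y16); apply: filterS => n /= nle.
have /andP[_ ->] := step_approx_itv n y2; rewrite andbT.
have /andP[t0 t1] := step_base_itv n y2.
set N := (n.+4 ^ 2)%N.
have u1 : step_base n y ^+ N <= 1 by rewrite exprn_ile1.
rewrite /step_approx -/N.
have B : -1 <= - step_base n y ^+ N by rewrite lerN2.
apply: le_trans (Bernoulli_le (2 ^ N) B).
rewrite natrX mulrN lerD2l lerN2 -exprMn.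
apply: (@le_trans _ _ (r ^+ N)).
  rewrite lerXn2r ?nnegrE//; first by rewrite mulr_ge0.
  by rewrite /step_base /r; move: (n.+4%:R^-1) nle => k nle; lra.
apply: ler_wiXn2l => //; first exact: ltW.
apply: leq_trans (leqW (leqW (leqW (leqnSn n)))) _.
by rewrite /N -mulnn leq_pmulr.
Qed.

(** With u = t^N and k = 2^N, use (1 - u)^k (1 + u)^k <= 1 and bound (1 + u)^k from
below by Bernoulli. *)
Lemma step_approx_ge0 y : `|y| <= 2 -> 0 <= y ->
  step_approx n y @[n --> \oo] --> (0 : R).
Proof.
move=> y2 y0.
apply: (squeeze_cvgr (f := fun=> 0) (h := harmonic)); last 2 first.
- exact: cvg_cst.
- exact: cvg_harmonic.
apply: nearW => n; have /andP[-> _] := step_approx_itv n y2 => /=.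
have /andP[t0 t1] := step_base_itv n y2.
rewrite /step_approx; set N := (n.+4 ^ 2)%N; set u := step_base n y ^+ N.
have u1 : u <= 1 by rewrite exprn_ile1.
have u0 : 0 <= u by rewrite exprn_ge0.
have n0 : 0 < (n.+4%:R : R) by [].
have h1 : n.+1%:R <= 2 ^+ N * u.
  rewrite -exprMn; apply: (@le_trans _ _ ((1 + 2 / n.+4%:R) ^+ N)); last first.
    rewrite lerXn2r ?nnegrE ?mulr_ge0 ?addr_ge0 ?divr_ge0//.
    rewrite /step_base; move: (n.+4%:R^-1) => k; lra.
  have B : -1 <= (2 : R) / n.+4%:R by rewrite (@le_trans _ _ 0)// divr_ge0.
  apply: le_trans (Bernoulli_le N B).
  have -> : N%:R * (2 / n.+4%:R) = 2 * n.+4%:R :> R by rewrite /N natrX; field; rewrite gt_eqF.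
  by rewrite -natrM -[X in X + _]/(1%:R) -natrD ler_nat; lia.
have h2 : 1 + (2 ^ N)%:R * u <= (1 + u) ^+ (2 ^ N).
  by apply: Bernoulli_le; rewrite (@le_trans _ _ 0).
have h3 : (1 - u) ^+ (2 ^ N) * (1 + u) ^+ (2 ^ N) <= 1.
  by rewrite -exprMn -subr_sqr expr1n exprn_ile1// ?subr_ge0 ?expr_le1// gerBl sqr_ge0.
have h4 : 0 <= (1 - u) ^+ (2 ^ N) by rewrite exprn_ge0// subr_ge0.
rewrite /harmonic -(ler_pM2r (_ : 0 < n.+1%:R))// mulVf//.
apply: le_trans h3; apply: ler_wpM2l => //; apply: le_trans h2.
by rewrite natrX (le_trans h1)// lerDr.
Qed.

End step_approximation.

Section orthants.
Context {R : realType} {d : nat}.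
Local Notation V := 'rV[R]_d.

Definition orthant (c : V) : set V := [set x | forall i, c 0 i < x 0 i].
(** A pi-system of sets whose indicators are, inside the cell, limits of
trigonometric polynomials. *)
Definition orthants : set (set V) := [set orthant c | c in setT].

Lemma orthant_measurable c : measurable (orthant c).
Proof.
have -> : orthant c = \bigcap_(i in [set: 'I_d]) (rV_coors i @^-1` `]c 0 i, +oo[).
  apply/seteqP; split => x /= h i; first by move=> _; rewrite /= in_itv/= andbT; exact: h.
  by have := h i I; rewrite /= in_itv/= andbT.
apply: fin_bigcap_measurable => // i _.
by rewrite -[X in measurable X]setTI; exact: measurable_rV_coors.
Qed.

Lemma orthantsI : setI_closed orthants.
Proof.
move=> _ _ [c _ <-] [c' _ <-].
exists (\row_i Num.max (c 0 i) (c' 0 i)) => //.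
apply/seteqP; split => x /=.
  by move=> h; split=> i; have := h i; rewrite mxE gt_max => /andP[].
by move=> [h h'] i; rewrite mxE gt_max h h'.
Qed.

(** A half-space is a countable union of orthants whose other coordinates are bounded
below by -n. *)
Lemma measurable_orthants : @measurable _ V = <<s orthants >>.
Proof.
apply/seteqP; split; last first.
  apply: smallest_sub; first exact: sigma_algebra_measurable.
  by move=> _ [c _ <-]; exact: orthant_measurable.
apply: smallest_sub; first exact: smallest_sigma_algebra.
rewrite -bigcup_seq => A [i _] [C mC <-].
pose W := g_sigma_algebraType orthants.
suff mi : measurable_fun [set: W] (rV_coors i : W -> measurableTypeR R) by exact: mi.
apply: (measurability _ (RGenOInfty.measurableE R)).
move=> _ [_ [c ->] <-]; rewrite setTI.
pose cn n : V := \row_j (if j == i then c else - n%:R).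
have -> : rV_coors i @^-1` `]c, +oo[ = \bigcup_n orthant (cn n).
  apply/seteqP; split => x /=; rewrite in_itv/= andbT.
    move=> cx; exists (Num.truncn `|x|).+1 => // j; rewrite mxE; case: eqP => [->//|_].
    have xj : `|x 0 j| <= `|x|.
      by rewrite [X in _ <= X]/Num.norm/= mx_normrE; exact: (le_bigmax _ _ (ord0, j)).
    have := truncnS_gt `|x|.
    by move: xj; rewrite ler_norml => /andP[]; lra.
  by move=> [n _ /(_ i)]; rewrite mxE eqxx.
apply: bigcupT_measurable => n; apply: sub_sigma_algebra; by exists (cn n).
Qed.

End orthants.

(** * Totality of the Hartley functions *)

Section totality.
Context {R : realType} {d : nat}.
Local Notation V := 'rV[R]_d.
Variables (a b : V).
Hypothesis ab : forall i, a 0 i < b 0 i.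
Local Notation mu := (box_measure a b).

Lemma ae_interior : {ae mu, forall x : V, forall i, a 0 i < x 0 i < b 0 i}.
Proof.
have face i c : {ae mu, forall x : V, x 0 i != c}.
  have mi : measurable [set x : V | x 0 i = c].
    rewrite -[X in measurable X]setTI; apply: (@measurable_rV_coors R d i measurableT [set c]).
    exact: measurable_set1.
  exists [set x : V | x 0 i = c]; split => //; last by move=> x /= /negP; rewrite negbK => /eqP.
  apply/eqP; rewrite /= /mrestr -measure_le0 -(lebesgue_rV_hyperplane i c).
  apply: le_measure; rewrite ?inE//.
  by apply: measurableI => //; exact: measurable_box.
have inbox : {ae mu, forall x, box a b x}.
  exists (~` box a b); split=> //; first by apply: measurableC; exact: measurable_box.
  exact: mrestr_setC.
have faces : {ae mu, forall x : V, forall i, x 0 i != a 0 i /\ x 0 i != b 0 i}.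
  by apply: filter_forall => i; apply: filterS2 (face i (a 0 i)) (face i (b 0 i)).
apply: filterS2 inbox faces => x xab xn i.
have [na nb] := xn i; have /andP[h1 h2] := xab i.
by rewrite !lt_neqAle h1 h2 nb eq_sym na.
Qed.

(** The difference cos(pi (2 x_i - a_i - c_i) / L) - cos(pi (c_i - a_i) / L), where
L = b_i - a_i: the first cosine has period L in x_i and takes the second value
exactly at the end a_i and at c_i, so inside the cell the sign tells on which
side of c_i the point is. The product form makes that sign visible. *)
Definition level (c : V) i (x : V) : R :=
  - 2 * sin (pi * (x 0 i - a 0 i) / (b 0 i - a 0 i)) *
        sin (pi * (x 0 i - c 0 i) / (b 0 i - a 0 i)).

Lemma level_le2 c i x : `|level c i x| <= 2.
Proof.
rewrite /level !normrM normrN -mulrA (ger0_norm (x := 2))//.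
by rewrite -[leRHS]mulr1 ler_wpM2l// mulr_ile1// sin_max.
Qed.

Lemma freq_delta i (x : V) :
  dotv (freq a b (\row_j (i == j)%:R)) x = pi *+ 2 * x 0 i / (b 0 i - a 0 i).
Proof.
rewrite /dotv (bigD1 i)//= big1 ?addr0; first by rewrite !mxE eqxx mulr1 mulrAC.
by move=> j ji; rewrite !mxE eq_sym (negbTE ji) mulr0 !mul0r.
Qed.

Lemma trig_level c i : trig a b (level c i).
Proof.
set L := b 0 i - a 0 i; have L0 : L != 0 by rewrite gt_eqF// subr_gt0.
(* The phase is the midpoint of a_i and c_i, for the frequency 2 pi / L. *)
pose k := pi * (a 0 i + c 0 i) / L.
pose m : 'rV[int]_d := \row_j (i == j)%:R.
have -> : level c i = fun x => (cos k * cos (dotv (freq a b m) x) +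
    sin k * sin (dotv (freq a b m) x)) + - cos (pi * (c 0 i - a 0 i) / L).
  apply/funext => x; rewrite freq_delta -/L /level -/L.
  set u := pi * (x 0 i - a 0 i) / L; set v := pi * (x 0 i - c 0 i) / L.
  have -> : pi * (c 0 i - a 0 i) / L = u - v by rewrite /u /v; field.
  rewrite -cosB.
  have -> : k - pi *+ 2 * x 0 i / L = - (u + v) by rewrite /u /v /k mulr2n; field.
  rewrite cosN cosD cosB; ring.
apply: trigD; last exact: trig_cst.
by apply: trigD; apply: trigZ; [exact: trig_cos|exact: trig_sin].
Qed.

Lemma level_lt0 (c : V) i (x : V) : a 0 i <= c 0 i < b 0 i -> a 0 i < x 0 i < b 0 i ->
  (level c i x < 0) = (c 0 i < x 0 i).
Proof.
move=> /andP[ac cb] /andP[ax xb].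
rewrite /level; set L := b 0 i - a 0 i; have L0 : 0 < L by rewrite subr_gt0.
set u := pi * _ / L; set v := pi * _ / L.
have pi0 := pi_gt0 R.
have su : 0 < sin u.
  apply: sin_gt0_pi; apply/andP; split.
    by rewrite divr_gt0// mulr_gt0// subr_gt0.
  rewrite /u ltr_pdivrMr// ltr_pM2l// /L; lra.
rewrite -mulrA mulNr oppr_lt0 pmulr_rgt0// pmulr_rgt0//.
have vlt : v < pi by rewrite /v ltr_pdivrMr// ltr_pM2l// /L; lra.
have vgt : - pi < v by rewrite /v ltr_pdivlMr// mulNr -mulrN ltr_pM2l// /L; lra.
have [cx|xc] := ltP (c 0 i) (x 0 i).
  by apply: sin_gt0_pi; rewrite vlt andbT divr_gt0// mulr_gt0// subr_gt0.
apply/negbTE; rewrite -leNgt.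
have v0 : v <= 0.
  rewrite /v mulr_le0_ge0 ?invr_ge0 ?(ltW L0)//.
  by rewrite mulr_ge0_le0 ?(ltW pi0)// subr_le0.
rewrite -oppr_ge0 -sinN; apply: sin_ge0_pi; rewrite oppr_ge0 v0/=; lra.
Qed.

Lemma ip_trig f : f \in Lfun mu 2%:E -> (forall m, ip a b f (hartley a b m) = 0) ->
  forall g, trig a b g -> ip a b f g = 0.
Proof.
move=> fL f0 g; elim=> {g} [m||g g' tg IH tg' IH'|k g tg IH].
- exact: f0.
- by rewrite /ip dotC dot0l.
- rewrite /ip dotC dotDl//; [|exact: (trig_L2per ab _).2..].
  by rewrite [X in X + _]dotC [X in _ + X]dotC -/(ip a b f g) -/(ip a b f g') IH IH' addr0.
- rewrite /ip dotC dotZl//; last exact: (trig_L2per ab _).2.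
  by rewrite [X in _ * X]dotC -/(ip a b f g) IH mulr0.
Qed.

(** Inside the cell the indicator of the orthant is the product over the
coordinates of the indicators of level < 0, hence a bounded limit of trigonometric
polynomials; dominated convergence applies. *)
Lemma integral_orthant f : f \in Lfun mu 2%:E ->
  (forall g, trig a b g -> ip a b f g = 0) ->
  forall c, (\int[mu]_(x in orthant c) (f x)%:E = 0)%E.
Proof.
move=> fL f0 c.
have mf := L2_measurable fL.
have fi := L2_integrable (box_measure_fin a b) fL.
have [/existsP[i ci]|/existsPn cb] := boolP [exists i, b 0 i <= c 0 i].
  rewrite integral_mkcond; have -> : (0 = \int[mu]_(x in setT) 0)%E by rewrite integral0.
  apply: ae_eq_integral => //.
    by apply/(measurable_restrictT _ (orthant_measurable c)); apply/measurable_EFinP; exact: measurable_funTS.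
  apply: filterS ae_interior => x xab _; rewrite patchE memNset//= => /(_ i) cx.
  by have /andP[_ xb] := xab i; move: (lt_le_trans (lt_trans cx xb) ci); rewrite ltxx.
(* Raising c to the cell does not change the orthant inside the open cell. *)
pose c' : V := \row_i Num.max (a 0 i) (c 0 i).
have c'ab i : a 0 i <= c' 0 i < b 0 i.
  by rewrite mxE le_max lexx/= gt_max ab ltNge cb.
pose E n x := \prod_i step_approx n (level c' i x).
have tE n : trig a b (E n).
  apply: trig_prod => i; apply: trigX => //.
  have -> : (fun x => 1 - step_base n (level c' i x) ^+ (n.+4 ^ 2)) =
      (fun x => 1 + -1 * step_base n (level c' i x) ^+ (n.+4 ^ 2)).
    by apply/funext => x; rewrite mulN1r.
  apply: trigD; first exact: trig_cst.
  apply: trigZ; apply: trigX.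
  have -> : (fun x => step_base n (level c' i x)) =
      (fun x => 8^-1 * level c' i x + (2^-1 + n.+4%:R^-1)).
    by apply/funext => x; rewrite /step_base mulrC -addrA addrCA.
  by apply: trigD; [apply: trigZ; exact: trig_level|exact: trig_cst].
have E01 n x : 0 <= E n x <= 1.
  apply/andP; split; first by apply: prodr_ge0 => i _; have /andP[] := step_approx_itv n (level_le2 c' i x).
  by rewrite prodr_ile1// => i _; exact: step_approx_itv (level_le2 c' i x).
have mE n : measurable_fun setT (E n).
  by apply: continuous_rV_measurable; exact: trig_continuous (tE n).
have Ecv (x : V) : (forall i, a 0 i < x 0 i < b 0 i) ->
    E n x @[n --> \oo] --> (\1_(orthant c) x : R).
  move=> xab; have [xc|xc] := pselect (orthant c x).
    rewrite indicE mem_set//.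
    have step1 i : step_approx n (level c' i x) @[n --> \oo] --> (1 : R).
      apply: step_approx_lt0; first exact: level_le2.
      by rewrite level_lt0// mxE gt_max xc andbT; have /andP[] := xab i.
    rewrite /E; elim: (index_enum _) => [|i s IH].
      by under eq_fun do rewrite big_nil; exact: cvg_cst.
    under eq_fun do rewrite big_cons.
    have := @cvgM _ _ _ _ _ _ _ _ (step1 i) IH; rewrite mulr1; exact.
  rewrite indicE memNset//.
  have [i ci] : exists i, x 0 i <= c 0 i.
    by apply: contrapT => h; apply: xc => i; rewrite ltNge; apply/negP => xci; apply: h; exists i.
  apply: (squeeze_cvgr (f := fun=> 0) (h := fun n => step_approx n (level c' i x))); last 2 first.
  - exact: cvg_cst.
  - apply: step_approx_ge0; first exact: level_le2.
    by rewrite leNgt level_lt0// mxE -leNgt le_max ci orbT.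
  apply: nearW => n; have /andP[-> _] /= := E01 n x.
  have step01 j := step_approx_itv n (level_le2 c' j x).
  rewrite /E (bigD1 i)//= ler_piMr//; first by have /andP[] := step01 i.
  exact: prodr_ile1.
have cvE : (fun n => \int[mu]_x (f x * E n x)%:E)%E @ \oo -->
    (\int[mu]_x (f x * \1_(orthant c) x)%:E)%E.
  have [] // := @dominated_convergence _ _ _ mu setT measurableT
    (fun n x => (f x * E n x)%:E) (fun x => (f x * \1_(orthant c) x)%:E)
    (fun x => `|f x|%:E).
  - by move=> n; apply/measurable_EFinP; exact: measurable_funM.
  - apply/measurable_EFinP; apply: measurable_funM => //.
    by apply/measurable_indic; exact: orthant_measurable.
  - apply: filterS ae_interior => x xab _.
    have h : (fun n => f x * E n x) @ \oo --> f x * \1_(orthant c) x.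
      by apply: cvgM; [exact: cvg_cst|exact: Ecv].
    by apply/cvg_EFin; [exact: nearW|exact: h].
  - exact: (integrable_abse fi).
  apply: aeW => x n _; have /andP[E0 E1] := E01 n x.
  by rewrite lee_fin normrM ler_piMr// ger0_norm.
have E0 : (fun n => \int[mu]_x (f x * E n x)%:E)%E = (fun=> 0%E).
  apply/funext => n; have := f0 _ (tE n); rewrite /ip /Rintegral => h.
  rewrite -[LHS]fineK ?h//.
  apply: integrable_fin_num => //; apply: L2_mul_integrable => //.
  exact: (trig_L2per ab (tE n)).2.
rewrite integral_mkcond.
have -> : ((fun x => (f x)%:E) \_ (orthant c) = (fun x => (f x * \1_(orthant c) x)%:E))%E.
  apply/funext => x; rewrite patchE indicE; case: ifP => _ /=; by rewrite ?mulr1 ?mulr0.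
move: cvE; rewrite E0 => /cvg_lim <- //.
by rewrite lim_cst.
Qed.

(** The sets on which f has integral zero are closed under complements and disjoint
unions, and contain the orthants, so they are all measurable sets. *)
Lemma hartley_total f : f \in Lfun mu 2%:E ->
  (forall m, ip a b f (hartley a b m) = 0) -> {ae mu, forall x, f x = 0}.
Proof.
move=> fL f0; have ft := ip_trig fL f0.
have fi := L2_integrable (box_measure_fin a b) fL.
have fiS A : measurable A -> mu.-integrable A (EFin \o f).
  by move=> mA; apply: integrableS fi.
have int0 A : measurable A -> (\int[mu]_(x in A) (f x)%:E = 0)%E.
  move=> mA; pose P : set_system V := fun A => (\int[mu]_(x in A) (f x)%:E = 0)%E.
  have PT : P setT.
    have := ft _ (@trig_cst R d a b 1); rewrite /ip.
    under eq_Rintegral do rewrite mulr1.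
    by rewrite /Rintegral /P => h; rewrite -[LHS]fineK ?h//; exact: integrable_fin_num.
  apply: (@dynkin_induction _ V orthants P (@measurable_orthants R d)) => //.
  - exact: orthantsI.
  - by move=> _ [c _ <-]; exact: integral_orthant.
  - move=> S mS; rewrite /P => PS.
    have := PT; rewrite /P -(setvU S) integral_setU_EFin//.
    + by rewrite PS adde0.
    + exact: measurableC.
    + by rewrite setvU; exact: L2_measurable fL.
    + by rewrite disj_set2E setICl.
  - move=> F mF tF PF; rewrite /P integral_bigcup//; last exact: fiS (bigcupT_measurable _ mF).
    by apply: eseries0 => i _ _; exact: PF.
  - by rewrite -measurable_orthants.
have : ae_eq mu setT (EFin \o f) (cst 0%E).
  apply: integral_ae_eq => //.
  by move=> A _ mA; rewrite integral0; exact: int0.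
by apply: filterS => x /(_ I) [].
Qed.

End totality.

(** * Weak gradients and the periodic Poisson problem *)

Section weak_gradient.
Context {R : realType} {d : nat}.
Local Notation V := 'rV[R]_d.
Variables (a b : V).
Hypothesis ab : forall i, a 0 i < b 0 i.
Local Notation mu := (box_measure a b).
Local Notation vol := (fine (mu setT)).
Local Notation L2 f := (f \in Lfun mu 2%:E).
Local Notation hartley := (hartley a b).
Local Notation freq := (freq a b).
Local Notation mode := 'rV[int]_d.

Let vol_gt0 : 0 < vol := box_measure_gt0 ab.
Let mu_fin : (mu setT < +oo)%E := box_measure_fin a b.

Lemma hartley_L2 m : L2 (hartley m).
Proof. exact/continuous_L2/continuous_hartley. Qed.

(** The terms of a series with coefficients c, listed along the enumeration of Z^d.
The map s is the identity or the opposite, the latter for the derivatives of a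
series. *)
Definition wave (c : mode -> R) (s : mode -> mode) (k : nat) : V -> R :=
  if pickle_inv k is Some m then fun x => c m * hartley (s m) x else fun=> 0.

Lemma wave_trig c s k : trig a b (wave c s k).
Proof.
by rewrite /wave; case: pickle_inv => [m|]; [apply: trigZ; exact: trig_hartley|exact: trig0].
Qed.

Lemma wave_L2 c s k : L2 (wave c s k).
Proof. by have [] := trig_L2per ab (wave_trig c s k). Qed.

Lemma wave_orthogonal c s j k : injective s -> j != k ->
  ip a b (wave c s j) (wave c s k) = 0.
Proof.
move=> s_inj jk; rewrite /wave /ip.
have := @pickle_invK mode j; have := @pickle_invK mode k.
case: (pickle_inv k) => [m|]; last by rewrite dotC dot0l.
case: (pickle_inv j) => [m'|] /=; last by rewrite dot0l.
move=> mk mj; have mm' : s m' != s m.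
  by rewrite (inj_eq s_inj); apply: contra_neq jk => mm'; rewrite -mj -mk mm'.
rewrite (dotZZ _ _ (hartley_L2 _) (hartley_L2 _)).
rewrite -/(ip a b (hartley (s m')) (hartley (s m))) hartley_orthogonal//.
by rewrite (negbTE mm') mulr0.
Qed.

Definition fourier (u : V -> R) (m : mode) : R := ip a b u (hartley m) / vol.

Definition coef2 (c : mode -> R) (k : nat) : R :=
  if pickle_inv k is Some m then c m ^+ 2 else 0.

Lemma wave_sqnorm c s k : ip a b (wave c s k) (wave c s k) = coef2 c k * vol.
Proof.
rewrite /wave /coef2 /ip; case: (pickle_inv k) => [m|]; last by rewrite dot0l mul0r.
rewrite (dotZZ _ _ (hartley_L2 _) (hartley_L2 _)).
by rewrite -/(ip a b (hartley (s m)) (hartley (s m))) hartley_orthogonal// eqxx expr2.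
Qed.

Lemma ip_wave_fourier u k : L2 u ->
  ip a b (wave (fourier u) id k) u = coef2 (fourier u) k * vol.
Proof.
move=> uL; rewrite /wave /coef2 /ip; case: (pickle_inv k) => [m|]; last by rewrite dot0l mul0r.
rewrite dotZl//; last exact: hartley_L2.
rewrite dotC -/(ip a b u (hartley m)) expr2 -mulrA; congr (_ * _).
by rewrite /fourier divfK// gt_eqF.
Qed.

(** Expand the squared norm of the difference of u and its partial sum. *)
Lemma Bessel u n : L2 u ->
  \sum_(0 <= k < n) coef2 (fourier u) k * vol <= ip a b u u.
Proof.
move=> uL; pose S x := \sum_(0 <= k < n) wave (fourier u) id k x.
have SL : L2 S by apply: L2_sum => k; exact: wave_L2.
have := dot_ge0 mu (fun x => u x - S x); rewrite dotB2//.
have -> : Rintegral mu setT (fun x => S x * S x) = \sum_(0 <= k < n) coef2 (fourier u) k * vol.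
  rewrite (sqnorm_orthogonal_sum (wave_L2 (fourier u) id)) ?iota_uniq//.
    by apply: eq_bigr => k _; exact: wave_sqnorm.
  by move=> j k; exact: wave_orthogonal.
have -> : Rintegral mu setT (fun x => u x * S x) = \sum_(0 <= k < n) coef2 (fourier u) k * vol.
  rewrite dotC dot_suml//; last by move=> k; exact: wave_L2.
  by apply: eq_bigr => k _; exact: ip_wave_fourier.
by rewrite -/(ip a b u u); lra.
Qed.

(** By Bessel, coefficients that are dominated by those of a function in L2 define a
function in L2. *)
Lemma wave_series_cvg u (c : mode -> R) s C : L2 u -> injective s -> 0 <= C ->
  (forall m, c m ^+ 2 <= C * fourier u m ^+ 2) ->
  exists f, L2per a b f /\ forall g, L2 g ->
    \sum_(0 <= k < n) ip a b (wave c s k) g @[n --> \oo] --> ip a b f g.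
Proof.
move=> uL s_inj C0 cC.
have [|n|f [fL fext fcv]] := @orthogonal_series_cvg _ _ _ mu mu_fin (wave c s)
    (C * ip a b u u) (wave_L2 c s).
- by move=> j k; exact: wave_orthogonal.
- apply: (@le_trans _ _ (C * \sum_(0 <= k < n) coef2 (fourier u) k * vol)).
    rewrite mulr_sumr; apply: ler_sum => k _.
    rewrite [leLHS]wave_sqnorm mulrA ler_wpM2r ?(ltW vol_gt0)//.
    by rewrite /coef2; case: pickle_inv => [m|]; rewrite ?cC ?mulr0.
  by apply: ler_wpM2l => //; exact: Bessel.
exists f; split; last exact: fcv.
split=> // x i; apply: fext => k.
exact: (trig_periodic ab (wave_trig c s k)).
Qed.

(** The series converges to some function with the same coefficients as u, and by
totality this function is u. *)
Lemma fourier_series_cvg u g : L2 u -> L2 g ->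
  \sum_(0 <= k < n) ip a b (wave (fourier u) id k) g @[n --> \oo] --> ip a b u g.
Proof.
move=> uL gL.
have [||m|f [[_ fL] fcv]] := @wave_series_cvg u (fourier u) id 1 uL => //.
  by rewrite mul1r.
have fu : {ae mu, forall x, f x - u x = 0}.
  apply: (hartley_total ab); first exact: L2B.
  move=> m; rewrite /ip dotBl//; last exact: hartley_L2.
  apply/eqP; rewrite subr_eq0; apply/eqP.
  have /cvg_lim E := fcv _ (hartley_L2 m).
  rewrite -/(ip a b f (hartley m)) -E //; apply: lim_near_cst => //.
  exists (pickle m).+1 => // n /= mn.
  rewrite (bigD1_seq (pickle m)) ?mem_index_iota ?iota_uniq//=.
  rewrite big1 ?addr0 => [|k km].
    rewrite /wave pickleK_inv /ip dotZl; try exact: hartley_L2.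
    by rewrite -/(ip a b (hartley m) (hartley m)) hartley_orthogonal// eqxx /fourier divfK// gt_eqF.
  rewrite /wave; have := @pickle_invK mode k; case: pickle_inv => [m'|] /=; last first.
    by rewrite /ip dot0l.
  move=> mk; rewrite /ip dotZl; try exact: hartley_L2.
  rewrite -/(ip a b (hartley m') (hartley m)) hartley_orthogonal//.
  by case: eqP => [mm'|]; [rewrite -mk mm' eqxx in km|rewrite mulr0].
have -> : ip a b u g = ip a b f g.
  apply/eqP; rewrite eq_sym -subr_eq0 /ip -dotBl//; apply/eqP; apply: dot_ae0 => //.
    exact: (L2_measurable (L2B fL uL)).
  exact: (L2_measurable gL).
exact: fcv.
Qed.

Lemma weak_grad_L2 u G i : is_weak_grad a b u G -> L2 (fun x => G x 0 i).
Proof. by move=> [/(_ i)[]]. Qed.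

(** Tested with the Hartley functions, the definition of the weak gradient says that
G_i is orthogonal to all of them. *)
Lemma weak_grad_ae0 u G : is_weak_grad a b u G -> measurable_fun setT u ->
  {ae mu, forall x, u x = 0} -> forall i, {ae mu, forall x, G x 0 i = 0}.
Proof.
move=> uG mu_ u0 i; apply: (hartley_total ab); first exact: weak_grad_L2 uG.
move=> m; have tm := trig_hartley a b m; have [_ H] := uG.
have := H _ (trig_smooth tm) (hartley_periodic ab m) i.
rewrite [X in X = _]/ip dot_ae0//; last first.
  by apply: continuous_rV_measurable; apply: trig_continuous; exact: (trig_partial i tm).2.
by move/esym/eqP; rewrite oppr_eq0 => /eqP.
Qed.

Lemma smooth_L2 (psi : V -> R) : smooth psi -> L2 psi.
Proof. by move=> /(_ [::]) [c _]; exact: continuous_L2. Qed.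

Lemma smooth_partial (psi : V -> R) i : smooth psi -> smooth (partial i psi).
Proof. by move=> h s; have := h (rcons s i); rewrite foldr_rcons. Qed.

Lemma weak_grad_unique u G G' : L2 u -> is_weak_grad a b u G -> is_weak_grad a b u G' ->
  forall i, {ae mu, forall x, G x 0 i = G' x 0 i}.
Proof.
move=> uL uG uG' i.
suff : {ae mu, forall x, (G x - G' x) 0 i = 0}.
  by apply: filterS => x; rewrite !mxE => /eqP; rewrite subr_eq0 => /eqP.
apply: (@weak_grad_ae0 (fun=> 0) (fun x => G x - G' x)) => //; last exact: aeW.
have [pG HG] := uG; have [pG' HG'] := uG'.
split=> [j|psi spsi ppsi j].
  split=> [x k|]; first by rewrite !mxE (pG j).1 (pG' j).1.
  by under eq_fun do rewrite !mxE; apply: L2B; [exact: (pG j).2|exact: (pG' j).2].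
rewrite /ip dot0l; under [X in - X]eq_Rintegral do rewrite !mxE.
rewrite (dotBl (pG j).2 (pG' j).2 (smooth_L2 spsi)).
rewrite -/(ip a b (fun x => G x 0 j) psi) -/(ip a b (fun x => G' x 0 j) psi).
by have := HG _ spsi ppsi j; have := HG' _ spsi ppsi j; lra.
Qed.

Lemma gradP u : H1per a b u -> is_weak_grad a b u (grad a b u).
Proof. by move=> [_ [G uG]]; exact: (xgetPex _ (ex_intro _ G uG)). Qed.

Lemma grad_L2 u i : L2 (fun x => grad a b u x 0 i).
Proof.
rewrite /grad; case: xgetP => [G _ uG|_]; first exact: weak_grad_L2 uG.
by under eq_fun do rewrite mxE; exact: L20.
Qed.

Lemma ipv_sum (F G : V -> V) : (forall i, L2 (fun x => F x 0 i)) -> (forall i, L2 (fun x => G x 0 i)) ->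
  ipv a b F G = \sum_i ip a b (fun x => F x 0 i) (fun x => G x 0 i).
Proof.
move=> FL GL; rewrite /ipv /dotv.
elim: (index_enum _) => [|i s IH].
  by under eq_Rintegral do rewrite big_nil; rewrite Rintegral_cst// mul0r big_nil.
under eq_Rintegral do rewrite big_cons.
rewrite RintegralD//; first by rewrite IH big_cons.
  exact: L2_mul_integrable.
elim: s {IH} => [|j s IH].
  under eq_fun do rewrite big_nil; exact: cst_integrable.
under eq_fun do rewrite big_cons.
by apply: integrable_addr => //; exact: L2_mul_integrable.
Qed.

(** The eigenvalue of -Delta for the Hartley function of mode m. *)
Definition eigen (m : mode) : R := dotv (freq m) (freq m).

(** An upper bound for the inverses of the nonzero eigenvalues, so a constant for the
Poincare inequality on the cell. *)
Definition poincare_const : R := \sum_i ((b 0 i - a 0 i) / (pi *+ 2)) ^+ 2.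

Lemma freq2_le_eigen m i : freq m 0 i ^+ 2 <= eigen m.
Proof.
rewrite /eigen /dotv (bigD1 i)//= -expr2 lerDl sumr_ge0// => j _.
by rewrite -expr2 sqr_ge0.
Qed.

Lemma eigen_gt0_inv_le m : m != 0 -> 0 < eigen m /\ (eigen m)^-1 <= poincare_const.
Proof.
move=> m0; have [i mi] := mode_neq0 m0.
have L0 : 0 < b 0 i - a 0 i by rewrite subr_gt0.
have p0 : 0 < pi *+ 2 :> R by rewrite pmulrn_lgt0// pi_gt0.
pose w := (b 0 i - a 0 i) / (pi *+ 2).
have w0 : 0 < w by rewrite divr_gt0.
have h : (w ^+ 2)^-1 <= eigen m.
  apply: le_trans (freq2_le_eigen m i).
  have -> : freq m 0 i = (m 0 i)%:~R / w.
    by rewrite mxE /w invf_div mulrA [X in _ = X / _]mulrC.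
  rewrite [leRHS]exprMn [in leRHS]exprVn ler_peMl ?invr_ge0 ?sqr_ge0//.
  rewrite -(real_normK (num_real _)) -intr_norm exprn_ege1//.
  by rewrite -[1]/(1%:~R) ler_int -gtz0_ge1 normr_gt0.
have e0 : 0 < eigen m by apply: lt_le_trans h; rewrite invr_gt0 exprn_gt0.
split=> //; apply: (@le_trans _ _ (w ^+ 2)).
  by rewrite -[leRHS]invrK lef_pV2// posrE invr_gt0 exprn_gt0.
by rewrite /poincare_const (bigD1 i)//= -/w lerDl sumr_ge0// => j _; rewrite sqr_ge0.
Qed.

Lemma fourier_mean_zero u m : mean_zero a b u -> m = 0 -> fourier u m = 0.
Proof.
move=> u0 ->; rewrite /fourier /ip; under eq_Rintegral do rewrite hartley0 mulr1.
by rewrite u0 mul0r.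
Qed.

(** Differentiating twice comes back to the original modes, with a minus sign. *)
Lemma wave_partial c i k :
  partial i (wave c id k) = wave (fun m => c m * freq m 0 i) -%R k /\
  partial i (wave c -%R k) = wave (fun m => - (c m * freq m 0 i)) id k.
Proof.
rewrite /wave; case: (pickle_inv k) => [m|]; last first.
  by split; apply/funext => x; exact: derive_cst.
split; apply/funext => x.
  have [dh ph] := hartley_partial a b m i x.
  rewrite /partial [LHS](@deriveZ _ _ _ (hartley m) (c m))//.
  by rewrite [X in _ *: X]ph [LHS]mulrA.
have [dh ph] := hartley_partial a b (- m) i x.
rewrite /partial [LHS](@deriveZ _ _ _ (hartley (- m)) (c m))//.
rewrite [X in _ *: X]ph [LHS]mulrA.
by rewrite opprK freqN mxE mulrN.
Qed.

(** At m = 0 the inverse of the zero eigenvalue is 0, so the series has mean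
zero. *)
Definition poisson_coef u (m : mode) : R := - (fourier u m / eigen m).

Lemma eigen0 m : m = 0 -> eigen m = 0.
Proof.
by move=> ->; rewrite /eigen freq0 dotv0l.
Qed.

Lemma poincare_const_ge0 : 0 <= poincare_const.
Proof. by apply: sumr_ge0 => i _; exact: sqr_ge0. Qed.

Lemma poisson_coef_le u m : poisson_coef u m ^+ 2 <= poincare_const ^+ 2 * fourier u m ^+ 2.
Proof.
rewrite /poisson_coef; move: (fourier u m) => F; rewrite sqrrN exprMn mulrC ler_wpM2r ?sqr_ge0//.
have [m0|/eigen_gt0_inv_le[e0 ep]] := eqVneq m 0.
  by rewrite (eigen0 m0) invr0 expr0n/= sqr_ge0.
by rewrite lerXn2r// nnegrE ?poincare_const_ge0// invr_ge0 ltW.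
Qed.

Lemma poisson_coef_grad_le u i m :
  (poisson_coef u m * freq m 0 i) ^+ 2 <= poincare_const * fourier u m ^+ 2.
Proof.
rewrite /poisson_coef; move: (fourier u m) => F; rewrite mulNr sqrrN !exprMn -mulrA mulrC ler_wpM2r ?sqr_ge0//.
have [m0|/eigen_gt0_inv_le[e0 ep]] := eqVneq m 0.
  by rewrite (eigen0 m0) invr0 expr0n/= mul0r poincare_const_ge0.
apply: le_trans ep; rewrite -[leRHS]mul1r -[X in X * _ <= _]mulr1.
apply: (@le_trans _ _ ((eigen m)^-1 ^+ 2 * eigen m)).
  by rewrite mulr1 ler_wpM2l ?sqr_ge0// freq2_le_eigen.
by rewrite expr2 mulfVK ?gt_eqF// mul1r.
Qed.

(** The only mode at which the division by the eigenvalue loses information is 0,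
where the coefficient of u vanishes as well. *)
Lemma poisson_laplacian u k x : mean_zero a b u ->
  \sum_i partial i (partial i (wave (poisson_coef u) id k)) x = wave (fourier u) id k x.
Proof.
move=> u0; under eq_bigr => i _ do rewrite (wave_partial _ i k).1 (wave_partial _ i k).2.
rewrite /wave; case: (pickle_inv k) => [m|]; last by rewrite big1.
rewrite -mulr_suml; congr (_ * _).
have -> : \sum_i - (poisson_coef u m * freq m 0 i * freq m 0 i) = - poisson_coef u m * eigen m.
  rewrite /eigen /dotv mulr_sumr; apply: eq_bigr => i _; by rewrite mulrA !mulNr.
rewrite /poisson_coef opprK; have [m0|/eigen_gt0_inv_le[e0 ep]] := eqVneq m 0.
  by rewrite (eigen0 m0) mulr0 fourier_mean_zero.
by rewrite divfK// gt_eqF.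
Qed.

(** Sum the Fourier series of the solution and of its partial derivatives. The weak
formulation holds because it holds for the partial sums, which are smooth: the
definition of the weak gradient of Y then moves the derivatives onto them. *)
Lemma inv_lap_exists u : L2per a b u -> mean_zero a b u -> exists v, is_inv_lap a b u v.
Proof.
move=> [_ uL] u0; pose c := poisson_coef u.
have [v [vL vcv]] := wave_series_cvg uL (@inj_id mode) (sqr_ge0 poincare_const) (poisson_coef_le u).
have Gex i := wave_series_cvg uL (@oppr_inj mode) poincare_const_ge0 (poisson_coef_grad_le u i).
have [G GP] := choice Gex.
pose GV (x : V) : V := \row_i G i x.
have GVE i : (fun x => GV x 0 i) = G i by apply/funext => x; rewrite mxE.
have wc k : trig a b (wave c id k) by exact: wave_trig.
have vG : is_weak_grad a b v GV.
  split=> [i|psi spsi ppsi i]; rewrite GVE; first exact: (GP i).1.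
  have sL := smooth_L2 spsi; have spL := smooth_L2 (smooth_partial i spsi).
  have h1 := vcv _ spL; have h2 := (GP i).2 _ sL.
  have h3 : (fun n => - \sum_(0 <= k < n) ip a b (wave (fun m => c m * freq m 0 i) -%R k) psi)
      @ \oo --> - ip a b (G i) psi by exact: cvgN.
  apply: (cvg_unique _ h1); first exact: Rhausdorff.
  apply: cvg_trans h3; apply: near_eq_cvg; apply: nearW => n /=.
  rewrite -sumrN; apply: eq_bigr => k _.
  rewrite -(wave_partial c i k).1; apply/esym; apply: (ip_partial ab).
  - exact: trig_continuous (wc k).
  - exact: (trig_partial i (wc k)).1.
  - exact: trig_continuous (trig_partial i (wc k)).2.
  - exact: (spsi [::]).1.
  - exact: (spsi [::]).2.
  - exact: (spsi [:: i]).1.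
  - exact: trig_periodic (wc k).
  - exact: ppsi.
have vH : H1per a b v by split=> //; exists GV.
exists v; split=> //.
  have := vcv _ (hartley_L2 0); rewrite /mean_zero.
  have -> : ip a b v (hartley 0) = Rintegral mu setT v.
    by apply: eq_Rintegral => x _; rewrite hartley0 mulr1.
  move=> /cvg_lim <- //; apply: lim_near_cst => //; apply: nearW => n.
  rewrite big1// => k _; rewrite /wave; case: (pickle_inv k) => [m|]; last by rewrite /ip dot0l.
  rewrite /ip dotZl; try exact: hartley_L2.
  rewrite -/(ip a b (hartley m) (hartley 0)) hartley_orthogonal//.
  case: eqP => [m0|]; last by rewrite mulr0.
  by rewrite /poisson_coef (eigen0 m0) invr0 mulr0 oppr0 mul0r.
move=> Y YH; have gv := gradP vH; have [gY1 gY2] := gradP YH; have [[pY YL] _] := YH.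
have GL i : L2 (G i) by exact: (GP i).1.2.
rewrite /wlap /wdiv ipv_sum; try by move=> i; exact: grad_L2.
have -> : \sum_i ip a b (fun x => grad a b v x 0 i) (fun x => grad a b Y x 0 i) =
    \sum_i ip a b (G i) (fun x => grad a b Y x 0 i).
  apply: eq_bigr => i _; apply/eqP; rewrite -subr_eq0 /ip -dotBl; try exact: grad_L2; last exact: GL.
  apply/eqP; apply: dot_ae0.
  - have := weak_grad_unique vL.2 gv vG i; apply: filterS => x ->.
    by rewrite mxE subrr.
  - by apply: L2_measurable; apply: L2B; [exact: grad_L2|exact: GL].
  - exact: (L2_measurable (grad_L2 Y i)).
have h1 : (fun n => \sum_i \sum_(0 <= k < n)
    ip a b (wave (fun m => c m * freq m 0 i) -%R k) (fun x => grad a b Y x 0 i)) @ \oo -->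
    \sum_i ip a b (G i) (fun x => grad a b Y x 0 i).
  elim: (index_enum _) => [|i s IH].
    by under eq_fun do rewrite big_nil; rewrite big_nil; exact: cvg_cst.
  under eq_fun do rewrite big_cons; rewrite big_cons.
  by apply: cvgD; [exact: (GP i).2 _ (grad_L2 Y i)|exact: IH].
have h2 : (fun n => - \sum_(0 <= k < n) ip a b (wave (fourier u) id k) Y) @ \oo -->
    - ip a b u Y by apply: cvgN; exact: fourier_series_cvg.
apply/eqP; rewrite eqr_oppLR; apply/eqP.
apply: (cvg_unique _ h1); first exact: Rhausdorff.
apply: cvg_trans h2; apply: near_eq_cvg; apply: nearW => n /=.
rewrite -sumrN exchange_big /=; apply: eq_bigr => k _.
have -> : ip a b (wave (fourier u) id k) Y =
    \sum_i ip a b (partial i (partial i (wave c id k))) Y.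
  rewrite /ip -dot_suml//; last first.
    move=> i; apply: continuous_L2; apply: trig_continuous.
    exact: (trig_partial i (trig_partial i (wc k)).2).2.
  by apply: eq_Rintegral => x _; rewrite poisson_laplacian.
rewrite -sumrN; apply: eq_bigr => i _.
rewrite -(wave_partial c i k).1.
have tk := (trig_partial i (wc k)).2.
have := gY2 _ (trig_smooth tk) (trig_periodic ab tk) i.
rewrite /ip dotC => ->; rewrite opprK; exact: dotC.
Qed.

End weak_gradient.

(** * The bilinear form of the operator *)

Section operator_theory.
Context {R : realType} {d : nat}.
Local Notation V := 'rV[R]_d.
Variables (a b : V).
Hypothesis ab : forall i, a 0 i < b 0 i.
Local Notation mu := (box_measure a b).
Local Notation L2 f := (f \in Lfun mu 2%:E).
Local Notation gd := (grad a b).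
Local Notation IL := (inv_lap a b).

Lemma inv_lapP u : L2per a b u -> mean_zero a b u -> is_inv_lap a b u (IL u).
Proof. by move=> uL u0; exact: (xgetPex _ (inv_lap_exists ab uL u0)). Qed.

Local Opaque grad inv_lap.

Lemma ipC (f g : V -> R) : ip a b f g = ip a b g f.
Proof. exact: dotC. Qed.

Lemma ipvC F G : ipv a b F G = ipv a b G F.
Proof. by apply: eq_Rintegral => x _; rewrite dotvC. Qed.

Lemma ipv_ge0 F : 0 <= ipv a b F F.
Proof.
by apply: Rintegral_ge0 => x _; apply: sumr_ge0 => i _; rewrite -expr2 sqr_ge0.
Qed.

(** Both sides are, up to sign, the product of the gradients of the two solutions. *)
Lemma inv_lap_sym u w : L2per a b u -> mean_zero a b u -> L2per a b w -> mean_zero a b w ->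
  ip a b (IL u) w = ip a b (IL w) u.
Proof.
move=> uL u0 wL w0; have [vH _ vP] := inv_lapP uL u0; have [zH _ zP] := inv_lapP wL w0.
rewrite ipC -(zP _ vH) (ipC _ u) -(vP _ zH) /wlap /wdiv.
exact/congr1/ipvC.
Qed.

Lemma inv_lap_le0 u : L2per a b u -> mean_zero a b u -> ip a b (IL u) u <= 0.
Proof.
move=> uL u0; have [vH _ vP] := inv_lapP uL u0.
by rewrite ipC -(vP _ vH) /wlap /wdiv oppr_le0 ipv_ge0.
Qed.

(** The squared norm of u is the product of grad u with the gradient of Delta^-1 u,
up to sign. *)
Lemma grad_ae0_eq0 u : H1per a b u -> mean_zero a b u ->
  (forall i, {ae mu, forall x, gd u x 0 i = 0}) -> {ae mu, forall x, u x = 0}.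
Proof.
move=> uH u0 g0; have [uL _] := uH; have [vH _ vP] := inv_lapP uL u0.
apply: dot_eq0; first exact: uL.2.
rewrite -/(ip a b u u) -(vP _ uH) /wlap /wdiv ipvC ipv_sum; try by move=> i; exact: grad_L2.
rewrite big1 ?oppr0// => i _; apply: dot_ae0; first exact: g0.
  exact: (L2_measurable (grad_L2 a b u i)).
exact: (L2_measurable (grad_L2 a b _ i)).
Qed.

Lemma ipv_grad_eq0 u : ipv a b (gd u) (gd u) = 0 ->
  forall i, {ae mu, forall x, gd u x 0 i = 0}.
Proof.
rewrite ipv_sum; try by move=> i; exact: grad_L2.
move=> /eqP; rewrite psumr_eq0; last by move=> i _; exact: dot_ge0.
move=> /allP h i; apply: dot_eq0; first exact: grad_L2.
by apply/eqP; apply: h; rewrite mem_index_enum.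
Qed.

Lemma ip_sq_ge0 (f : V -> R) : 0 <= ip a b f f.
Proof. exact: dot_ge0. Qed.

Lemma ip_sq_eq0 (f : V -> R) : L2 f -> ip a b f f = 0 -> {ae mu, forall x, f x = 0}.
Proof. exact: dot_eq0. Qed.

Lemma ip_sqB (f g : V -> R) : L2 f -> L2 g ->
  ip a b (fun x => f x - g x) (fun x => f x - g x) =
  ip a b f f - 2 * ip a b f g + ip a b g g.
Proof. exact: dotB2. Qed.

Lemma ip_weight_sym (w f g : V -> R) :
  ip a b (fun x => w x * f x) g = ip a b (fun x => w x * g x) f.
Proof. by apply: eq_Rintegral => x _; rewrite mulrAC. Qed.

Lemma ip_weight_ge0 (w f : V -> R) : 0 <= ip a b (fun x => w x ^+ 2 * f x) f.
Proof.
by apply: Rintegral_ge0 => x _; rewrite -mulrA mulr_ge0// -?expr2 sqr_ge0.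
Qed.

(** The integrand is nonnegative and vanishes almost everywhere, whatever the
weight. *)
Lemma ip_weight_ae0 (w f : V -> R) : {ae mu, forall x, f x = 0} ->
  ip a b (fun x => w x ^+ 2 * f x) f = 0.
Proof.
move=> f0; apply: ge0_ae0_Rintegral.
  by move=> x; rewrite -mulrA mulr_ge0// -?expr2 sqr_ge0.
by apply: filterS f0 => x ->; rewrite mulr0.
Qed.

Lemma ip_ae0 (f g : V -> R) : {ae mu, forall x, f x = 0} -> L2 f -> L2 g -> ip a b f g = 0.
Proof. by move=> f0 fL gL; exact: (dot_ae0 f0 (L2_measurable fL) (L2_measurable gL)). Qed.

Lemma ipv_grad_ae0 u : (forall i, {ae mu, forall x, gd u x 0 i = 0}) ->
  ipv a b (gd u) (gd u) = 0.
Proof.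
move=> g0; rewrite ipv_sum; try by move=> i; exact: grad_L2.
by rewrite big1// => i _; exact: (ip_ae0 (g0 i) (grad_L2 a b u i) (grad_L2 a b u i)).
Qed.

Section quadratic_form.
Variables (eps alpha beta M1 M2 dt : R).
Variables (phis : V -> R) (Zs : V -> V) (Hs : V -> R).
Local Notation A := (opA a b eps alpha beta M1 M2 dt phis Zs Hs).
Local Notation zg u := (fun x => dotv (Zs x) (gd u x)).

(** The last factor is what symmetry and positivity rest on: the divergence of
rho Z* and the product Z*.grad phi are adjoint to each other. *)
Lemma pairing_opA X Y : pairing (A X) Y =
  - (3 / (2 * M1 * dt)) * ip a b (IL X.1) Y.1
  + eps * ipv a b (gd X.1) (gd Y.1)
  + 2 / eps * ip a b (fun x => phis x ^+ 2 * X.1 x) Y.1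
  - 3 / (2 * M2 * dt) * ip a b (IL X.2) Y.2
  + beta / 2 * ip a b (fun x => Hs x ^+ 2 * X.2 x) Y.2
  + alpha * (ip a b X.2 Y.2 - ip a b X.2 (zg Y.1) - ip a b (zg X.1) Y.2
             + ip a b (zg X.1) (zg Y.1)).
Proof.
have E1 : ipv a b (fun x => X.2 x *: Zs x) (gd Y.1) = ip a b X.2 (zg Y.1).
  by apply: eq_Rintegral => x _; rewrite dotvZl.
have E2 : ipv a b (fun x => zg X.1 x *: Zs x) (gd Y.1) = ip a b (zg X.1) (zg Y.1).
  by apply: eq_Rintegral => x _; rewrite dotvZl.
transitivity (- (3 / (2 * M1 * dt)) * ip a b (IL X.1) Y.1
  - eps * - ipv a b (gd X.1) (gd Y.1)
  + (2 / eps * ip a b (fun x => phis x ^+ 2 * X.1 x) Y.1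
     + alpha * - ipv a b (fun x => X.2 x *: Zs x) (gd Y.1)
     - alpha * - ipv a b (fun x => zg X.1 x *: Zs x) (gd Y.1))
  + (- (3 / (2 * M2 * dt)) * ip a b (IL X.2) Y.2
     + (alpha * ip a b X.2 Y.2 - alpha * ip a b (zg X.1) Y.2
        + beta / 2 * ip a b (fun x => Hs x ^+ 2 * X.2 x) Y.2))) => //.
rewrite E1 E2; ring.
Qed.

Local Opaque pairing opA ip ipv.

Lemma opA_sym X Y : admissible a b X -> admissible a b Y ->
  pairing (A X) Y = pairing (A Y) X.
Proof.
move=> [[X1 _] X10 X2 X20] [[Y1 _] Y10 Y2 Y20]; rewrite !pairing_opA.
rewrite (inv_lap_sym X1 X10 Y1 Y10) (inv_lap_sym X2 X20 Y2 Y20).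
rewrite (ipvC (gd X.1)) (ip_weight_sym _ X.1) (ip_weight_sym _ X.2).
rewrite (ipC X.2 Y.2) (ipC (zg X.1) (zg Y.1)) (ipC X.2 (zg _)) (ipC (zg X.1) Y.2).
ring.
Qed.

Hypotheses (heps : 0 < eps) (halpha : 0 < alpha) (hbeta : 0 < beta).
Hypotheses (hM1 : 0 < M1) (hM2 : 0 < M2) (hdt : 0 < dt).
Hypothesis ZsL : forall u i, L2 (fun x => Zs x 0 i * gd u x 0 i).

Let zgL u : L2 (zg u).
Proof. by apply: L2_sum => i; exact: ZsL. Qed.

(** Completing the square in the alpha terms leaves a sum of nonnegative terms. *)
Lemma opA_terms X : admissible a b X -> pairing (A X) X =
  3 / (2 * M1 * dt) * - ip a b (IL X.1) X.1
  + eps * ipv a b (gd X.1) (gd X.1)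
  + 2 / eps * ip a b (fun x => phis x ^+ 2 * X.1 x) X.1
  + 3 / (2 * M2 * dt) * - ip a b (IL X.2) X.2
  + beta / 2 * ip a b (fun x => Hs x ^+ 2 * X.2 x) X.2
  + alpha * ip a b (fun x => X.2 x - zg X.1 x) (fun x => X.2 x - zg X.1 x).
Proof.
move=> [_ _ [_ X2] _].
rewrite pairing_opA (ipC (zg X.1) X.2) (ip_sqB X2 (zgL X.1)); ring.
Qed.

Lemma opA_posdef X : admissible a b X -> 0 <= pairing (A X) X /\
  (pairing (A X) X = 0 <-> eq0_ae a b X).
Proof.
move=> XA; rewrite (opA_terms XA).
have [X1H X10 X2L X20] := XA; have [X1L _] := X1H.
set t1 := _ * - ip a b (IL X.1) X.1; set t2 := eps * _; set t3 := 2 / eps * _.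
set t4 := _ * - ip a b (IL X.2) X.2; set t5 := beta / 2 * _; set t6 := alpha * _.
have t10 : 0 <= t1.
  by rewrite mulr_ge0 ?divr_ge0 ?mulr_ge0 ?(ltW hM1) ?(ltW hdt)// oppr_ge0 inv_lap_le0.
have t20 : 0 <= t2 by rewrite mulr_ge0 ?(ltW heps)// ipv_ge0.
have t30 : 0 <= t3 by rewrite mulr_ge0 ?divr_ge0 ?(ltW heps)// ip_weight_ge0.
have t40 : 0 <= t4.
  by rewrite mulr_ge0 ?divr_ge0 ?mulr_ge0 ?(ltW hM2) ?(ltW hdt)// oppr_ge0 inv_lap_le0.
have t50 : 0 <= t5 by rewrite mulr_ge0 ?divr_ge0 ?(ltW hbeta)// ip_weight_ge0.
have t60 : 0 <= t6 by rewrite mulr_ge0 ?(ltW halpha)// ip_sq_ge0.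
have zg0 : (forall i, {ae mu, forall x, gd X.1 x 0 i = 0}) -> {ae mu, forall x, zg X.1 x = 0}.
  move=> g0; have : {ae mu, forall x, forall i, gd X.1 x 0 i = 0} by apply: filter_forall.
  apply: filterS => x gx.
  by rewrite /dotv big1// => i _; rewrite gx mulr0.
split; first by rewrite !addr_ge0.
split=> [S0|[X1e X2e]].
  have t2e : t2 = 0 by lra.
  have t6e : t6 = 0 by lra.
  have g0 : forall i, {ae mu, forall x, gd X.1 x 0 i = 0}.
    apply: ipv_grad_eq0; move/eqP : t2e; rewrite mulf_eq0 gt_eqF//= => /eqP; exact.
  split; first exact: grad_ae0_eq0.
  have /(ip_sq_eq0 (L2B X2L.2 (zgL X.1))) : ip a b (fun x => X.2 x - zg X.1 x) (fun x => X.2 x - zg X.1 x) = 0.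
    by move/eqP : t6e; rewrite mulf_eq0 gt_eqF//= => /eqP.
  by apply: filterS2 (zg0 g0) => x /= ->; rewrite subr0.
have g0 := weak_grad_ae0 ab (gradP X1H) (L2_measurable X1L.2) X1e.
have ILL u : L2per a b u -> mean_zero a b u -> L2 (IL u).
  by move=> uL u0; have [[[_ vL] _] _ _] := inv_lapP uL u0.
have -> : t1 = 0.
  by rewrite /t1 ipC (ip_ae0 X1e X1L.2 (ILL _ X1L X10)) oppr0 mulr0.
have -> : t4 = 0.
  by rewrite /t4 ipC (ip_ae0 X2e X2L.2 (ILL _ X2L X20)) oppr0 mulr0.
have -> : t2 = 0 by rewrite /t2 ipv_grad_ae0// mulr0.
have -> : t3 = 0 by rewrite /t3 ip_weight_ae0// mulr0.
have -> : t5 = 0 by rewrite /t5 ip_weight_ae0// mulr0.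
have d0 : {ae mu, forall x, X.2 x - zg X.1 x = 0}.
  by apply: filterS2 X2e (zg0 g0) => x -> ->; rewrite subr0.
have dL := L2B X2L.2 (zgL X.1).
have -> : t6 = 0 by rewrite /t6 (ip_ae0 d0 dL dL) mulr0.
by rewrite !addr0.
Qed.

End quadratic_form.

(** Where the gradient vanishes, so does Z, by the convention on the inverse of 0. *)
Lemma Zfield_le1 phi x i : `|Zfield a b phi x 0 i| <= 1.
Proof.
rewrite /Zfield mxE normrM; set g := gd phi x.
have gn : `|g 0 i| <= enorm g.
  rewrite -sqrtr_sqr ler_sqrt; last by apply: sumr_ge0 => j _; rewrite -expr2 sqr_ge0.
  rewrite /dotv (bigD1 i)//= -expr2 lerDl sumr_ge0// => j _.
  by rewrite -expr2 sqr_ge0.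
have [e0|e0] := eqVneq (enorm g) 0; first by rewrite e0 invr0 normr0 mul0r.
have ep : 0 < enorm g by rewrite lt_def e0 sqrtr_ge0.
by rewrite ger0_norm ?invr_ge0 ?(ltW ep)// mulrC ler_pdivrMr// mul1r.
Qed.

(** The inverse of the Euclidean norm is the power -1/2 of the squared norm,
also at 0. *)
Lemma measurable_Zfield phi i : measurable_fun setT (fun x => Zfield a b phi x 0 i).
Proof.
have mg j : measurable_fun setT (fun x => gd phi x 0 j).
  exact: (L2_measurable (grad_L2 a b phi j)).
rewrite /Zfield; under eq_fun do rewrite mxE.
apply: measurable_funM => //.
have -> : (fun x => (enorm (gd phi x))^-1) = (fun x => dotv (gd phi x) (gd phi x) `^ (- 2^-1)).
  apply/funext => x; rewrite powRN powR12_sqrt//.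
  by apply: sumr_ge0 => j _; rewrite -expr2 sqr_ge0.
apply: (measurableT_comp (measurable_powR _)).
rewrite /dotv; apply: measurable_sum => j; exact: measurable_funM.
Qed.

Lemma Zfield_L2 phi u i : L2 (fun x => Zfield a b phi x 0 i * gd u x 0 i).
Proof.
apply: L2_le (grad_L2 a b u i) _.
  apply: measurable_funM; first exact: measurable_Zfield.
  exact: (L2_measurable (grad_L2 a b u i)).
by move=> x; rewrite normrM ler_piMl// Zfield_le1.
Qed.

End operator_theory.

Theorem theorem3p3 (R : realType) (d : nat) (hd : d = 2%N \/ d = 3%N)
  (a b : 'rV[R]_d) (hab : forall i, a 0 i < b 0 i)
  (eps alpha beta M1 M2 : R)
  (heps : 0 < eps) (halpha : 0 < alpha) (hbeta : 0 < beta)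
  (hM1 : 0 < M1) (hM2 : 0 < M2)
  (ehat B : R) (hehat : 0 < ehat < 1 / 2) (hB : 0 < B)
  (hFH : forall r, 0 < FH ehat r + B)
  (dt : R) (hdt : 0 < dt)
  (phin phin1 rhon rhon1 Un Un1 Vn Vn1 Wn Wn1 : 'rV[R]_d -> R)
  (hphin : H1per a b phin) (hphin1 : H1per a b phin1)
  (hrhon : L2per a b rhon) (hrhon1 : L2per a b rhon1)
  (hUn : L2per a b Un) (hUn1 : L2per a b Un1)
  (hVn : L2per a b Vn) (hVn1 : L2per a b Vn1)
  (hWn : L2per a b Wn) (hWn1 : L2per a b Wn1) :
  let phis := fun x => 2 * phin x - phin1 x in
  let Zs := Zfield a b phis in
  let Hs := fun x => Hfun ehat B (2 * rhon x - rhon1 x) in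
  let A := opA a b eps alpha beta M1 M2 dt phis Zs Hs in
  (forall X Y, admissible a b X -> admissible a b Y ->
     pairing (A X) Y = pairing (A Y) X) /\
  (forall X, admissible a b X ->
     0 <= pairing (A X) X /\
     (pairing (A X) X = 0 <-> eq0_ae a b X)).
Proof.
move=> phis Zs Hs A; split=> [X Y XA YA|X XA]; first exact: opA_sym.
by apply: opA_posdef => // u i; exact: Zfield_L2.
Qed.
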